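(* Let $t \geq 2$ be an integer. There exists an integer $d = d(t)$ such that every graph with no odd $K_t$ minor is $(6t-9)$-colorable with defect $d$. Equivalently, the defective chromatic number of the class of graphs with no odd $K_t$ minor is at most $6t-9$.
   Context: All graphs are finite and simple. A graph $G$ contains a graph $H$ as an odd minor if there exist vertex-disjoint subgraphs $\{T_u\}_{u \in V(H)}$ of $G$, each of which is a tree, and a coloring $\alpha : \bigcup_{u \in V(H)} V(T_u) \to \{1,2\}$ such that for every $u \in V(H)$ every edge of $T_u$ is bichromatic (its ends receive different $\alpha$-values), and for every edge $vw \in E(H)$ there is a monochromatic edge of $G$ (its ends receive the same $\alpha$-value) joining $V(T_v)$ and $V(T_w)$. ''No odd $K_t$ minor'' means $G$ does not contain the complete graph $K_t$ as an odd minor. For integers $k,d \ge 0$, a graph $G$ is $k$-colorable with defect $d$ if there is a map $f: V(G) \to \{1,\dots,k\}$ such that each color class $f^{-1}(i)$ induces a subgraph of maximum degree at most $d$. The defective chromatic number of a class $\mathcal C$ of graphs is the minimum $k$ such that for some $d$ all graphs in $\mathcal C$ are $k$-colorable with defect $d$. *)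

(* Defs.v *)
(* Finite simple graphs: a symmetric irreflexive relation
   e : rel T on a finite type T. *)
From mathcomp Require Import all_boot.
Set Implicit Arguments. Unset Strict Implicit. Unset Printing Implicit Defensive.

Definition remove_edge (T : finType) (E : rel T) (x y : T) : rel T :=
  [rel a b | E a b && ~~ (((a == x) && (b == y)) || ((a == y) && (b == x)))].

(* (V, E) is a subgraph of the graph e which is a tree: E is a symmetric
   subrelation of e with both ends in V; V is nonempty; V is connected by E;
   and (E) is acyclic: every edge of E is a bridge. *)
Definition tree_subgraph (T : finType) (e : rel T) (V : {set T}) (E : rel T) : Prop :=
  [/\ (forall x y, E x y -> [/\ e x y, x \in V & y \in V]),
      (forall x y, E x y = E y x),
      V != set0,
      (forall x y, x \in V -> y \in V -> connect E x y) &
      (forall x y, E x y -> ~~ connect (remove_edge E x y) x y)].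

Definition has_odd_Kt_minor (T : finType) (e : rel T) (t : nat) : Prop :=
  exists (V : 'I_t -> {set T}) (E : 'I_t -> rel T) (alpha : T -> bool),
    [/\ (forall i j, i != j -> [disjoint V i & V j]),
        (forall i, tree_subgraph e (V i) (E i)),
        (forall i x y, E i x y -> alpha x != alpha y) &
        (forall i j, i != j ->
           exists x y, [/\ x \in V i, y \in V j, e x y & alpha x == alpha y])].

Definition defective_colorable (T : finType) (e : rel T) (k d : nat) : Prop :=
  exists f : T -> 'I_k,
    forall x, #|[set y | e x y & f y == f x]| <= d.

(* Main.v *)
Require Import Defs.
From mathcomp Require Import all_boot.
From mathcomp Require Import zify.
Set Implicit Arguments. Unset Strict Implicit. Unset Printing Implicit Defensive.

(** Write t = k + 2.  By induction one proves more: every precolouring of a set Z of at most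
    4k+1 vertices extends to a colouring with 6k+3 colours of bounded defect outside Z and
    with no monochromatic edge between Z and its complement.  In a minimal counterexample
    every vertex outside Z has degree at least 6k+3 and no edge outside Z joins two vertices
    of small degree; hence the vertices of small degree are independent and far outnumber the
    others, which yields a "core": a set S of at least 6k+3 vertices together with many disjoint
    connected bipartite pieces, each bipartitely adjacent to all of S.

    If there are k+1 disjoint odd S-paths, they can be rerouted so as to avoid k+2 of the
    pieces, and paths and pieces combine into an odd K_(k+2) minor.  Otherwise the
    Tutte-Berge formula, applied to an auxiliary graph whose matchings encode odd S-paths,
    yields a set X of at most 2k vertices such that G - X consists of a bipartite graph U
    containing S \ X, and of pieces attached to at most one vertex of U each.  The extension
    is then found by induction: either some piece contains more than 2k vertices of Z and the
    colouring is first extended to it, or X and U are given 2k + 2 colours not used on Z and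
    the colouring is extended to each piece separately. *)

(** * The Tutte-Berge formula *)

Lemma involution_even_card (T : finType) (f : T -> T) (A : {set T}) :
    involutive f -> (forall x, x \in A -> f x \in A) ->
    (forall x, x \in A -> f x != x) -> ~~ odd #|A|.
Proof.
move=> fK; have [n] := ubnP #|A|; elim: n A => // n IH A ltAn stA fxA.
have [->|[x xA]] := set_0Vmem A; first by rewrite cards0.
have fxA' : f x \in A :\ x by rewrite !inE fxA // stA.
have cA : #|A| = (#|A :\ x :\ f x|).+2.
  by rewrite (cardsD1 x) xA (cardsD1 (f x)) fxA'.
rewrite cA /= negbK; apply: IH => [|y|y]; first by lia.
- rewrite !inE => /and3P[yfx yx yA]; rewrite stA // andbT.
  by rewrite (inj_eq (inv_inj fK)) yx /= (can2_eq fK fK).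
- by rewrite !inE => /and3P[_ _ yA]; apply: fxA.
Qed.

Section TutteBerge.

Variables (T : finType) (h : rel T).
Hypothesis hsym : symmetric h.

(** Encoded as an involution: its fixed points are the unmatched vertices, and every vertex outside
    [W] is fixed. *)
Definition matching (W : {set T}) (m : {ffun T -> T}) : bool :=
  [forall x, (m (m x) == x) && ((m x != x) ==> h x (m x) && (x \in W))].

Definition missed (W : {set T}) (m : {ffun T -> T}) : {set T} :=
  [set x in W | m x == x].

Definition odd_labels (L : finType) (W : {set T}) (lab : T -> L) : {set L} :=
  [set k | odd #|[set x in W | lab x == k]|].

(** Labels stand in for components: a class of such a labelling is a union of components of the
    graph on [W], and odd classes replace the odd components of the formula. *)
Definition label_closed (L : finType) (W : {set T}) (lab : T -> L) : Prop :=
  forall x y, x \in W -> y \in W -> h x y -> lab x = lab y.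

Lemma matchingP (W : {set T}) (m : {ffun T -> T}) :
  reflect (involutive m /\ forall x, m x != x -> h x (m x) /\ x \in W)
          (matching W m).
Proof.
apply: (iffP forallP) => [mm|[mK mh] x].
  split=> [x|x mx]; first by case/andP: (mm x) => /eqP.
  by case/andP: (mm x) => _; rewrite mx => /andP.
by rewrite mK eqxx /=; apply/implyP=> /mh[-> ->].
Qed.

Lemma matching_in (W : {set T}) (m : {ffun T -> T}) x : matching W m -> m x != x -> m x \in W.
Proof.
case/matchingP=> mK mh mx; have [] := mh (m x) => //.
by rewrite mK eq_sym.
Qed.

Lemma missed_parity (W : {set T}) (m : {ffun T -> T}) : matching W m -> odd #|missed W m| = odd #|W|.
Proof.
move=> mm; have [mK mh] := matchingP _ _ mm.
rewrite -(cardsID (missed W m) W) oddD.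
rewrite (_ : W :&: missed W m = missed W m); last first.
  by apply/setIidPr/subsetP=> x; rewrite inE => /andP[].
rewrite (negPf (@involution_even_card _ m (W :\: missed W m) mK _ _)) ?addbF //.
  move=> x; rewrite !inE => /andP[+ xW]; rewrite xW /= => mx.
  by rewrite (matching_in mm) // mK eq_sym mx.
by move=> x; rewrite !inE => /andP[+ xW]; rewrite xW.
Qed.

Definition id_ffun : {ffun T -> T} := [ffun x => x].

Lemma matching_id (W : {set T}) : matching W id_ffun.
Proof. by apply/matchingP; split=> x; rewrite !ffunE ?eqxx. Qed.

Definition max_matching (W : {set T}) (m : {ffun T -> T}) : bool :=
  matching W m &&
  [forall m' : {ffun T -> T}, matching W m' ==> (#|missed W m| <= #|missed W m'|)].

Lemma max_matchingP (W : {set T}) m :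
  reflect (matching W m /\ forall m', matching W m' -> #|missed W m| <= #|missed W m'|)
          (max_matching W m).
Proof.
apply: (iffP andP) => -[mm H]; split=> //.
  by move=> m' mm'; apply: (implyP (forallP H m')).
by apply/forallP=> m'; apply/implyP; apply: H.
Qed.

Lemma max_matching_exists (W : {set T}) : exists m, max_matching W m.
Proof.
case: (@arg_minnP _ id_ffun (matching W) (fun m => #|missed W m|) (matching_id W)).
by move=> m mm H; exists m; apply/max_matchingP; split.
Qed.

Lemma max_matching_card (W : {set T}) m n :
  max_matching W m -> max_matching W n -> #|missed W m| = #|missed W n|.
Proof.
by case/max_matchingP=> mm Hm /max_matchingP[nn Hn]; apply/eqP; rewrite eqn_leq Hm ?Hn.
Qed.

(* The exchange [n - yz + xy] of the matching [n], where [z = n y]. *)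
Definition exchange (n : {ffun T -> T}) (x y : T) : {ffun T -> T} :=
  [ffun a => if a == x then y else if a == y then x else
             if a == n y then a else n a].

Lemma exchange_matching (W : {set T}) n x y :
  matching W n -> n x = x -> h x y -> x != y -> x \in W -> y \in W ->
  matching W (exchange n x y).
Proof.
move=> nn nx hxy xy xW yW; have [nK nh] := matchingP _ _ nn.
have n_inj := inv_inj nK.
have yx : (y == x) = false by rewrite eq_sym (negPf xy).
apply/matchingP; split=> a; rewrite !ffunE.
  case: (altP (a =P x)) => [->|ax]; first by rewrite eqxx yx.
  case: (altP (a =P y)) => [->|ay]; first by rewrite eqxx.
  case: (altP (a =P n y)) => [E|any]; rewrite ?E in ax ay *.
    by rewrite (negPf ax) (negPf ay) eqxx.
  rewrite -{1}nx (inj_eq n_inj) (negPf ax) (inj_eq n_inj) (negPf ay) nK.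
  by rewrite -{1}[y]nK (inj_eq n_inj) (negPf any).
case: (altP (a =P x)) => [->|ax]; first by [].
case: (altP (a =P y)) => [->|ay]; first by rewrite hsym.
by case: (altP (a =P n y)) => [->|any]; [rewrite eqxx | apply: nh].
Qed.

(* Two vertices are related when no maximum matching misses both; when every vertex
   is missed by some maximum matching this is transitive (Gallai's lemma). *)
Definition never_both_missed (W : {set T}) u v : bool :=
  (u == v) || [forall m, max_matching W m ==> ~~ ((m u == u) && (m v == v))].

Lemma never_both_missedP (W : {set T}) u v m :
  never_both_missed W u v -> u != v -> max_matching W m -> m u = u -> m v = v -> False.
Proof.
move=> + uv mm mu mv; rewrite /never_both_missed (negPf uv) => /forallP/(_ m).
by rewrite mm mu mv !eqxx.
Qed.

Lemma never_both_missed_sym (W : {set T}) u v :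
  never_both_missed W u v = never_both_missed W v u.
Proof.
by rewrite /never_both_missed eq_sym; congr (_ || _); apply: eq_forallb => m; rewrite andbC.
Qed.

(** Otherwise the edge could be added to a maximum matching. *)
Lemma never_both_missed_edge (W : {set T}) u v : u \in W -> v \in W -> h u v ->
  never_both_missed W u v.
Proof.
move=> uW vW huv; rewrite /never_both_missed; case: (altP (u =P v)) => //= uv.
apply/forallP=> m; apply/implyP=> /max_matchingP[mm Hm]; apply/negP=> /andP[/eqP mu /eqP mv].
have := Hm _ (exchange_matching mm mu huv uv uW vW); rewrite leqNgt => /negP; apply.
apply: proper_card; apply/properP; split.
  apply/subsetP=> a; rewrite !inE ffunE => /andP[->] /=.
  have [->|_] := eqVneq a u; first by rewrite mu eqxx.
  have [->|_] := eqVneq a v; first by rewrite mv eqxx.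
  by have [->|//] := eqVneq a (m v); rewrite !mv eqxx.
by exists u; rewrite !inE ?ffunE ?uW ?mu ?eqxx //= eq_sym.
Qed.

(** Suppose a maximum matching [m] misses [u] and [v]. Among the maximum matchings missing [w], take
    [n] agreeing with [m] in as many places as possible. It covers [u] and [v], so by counting it
    misses some [x] other than [w] that [m] covers. Exchanging the edge of [n] at [m x] for the edge
    from [x] to [m x] increases the agreement. *)
Lemma never_both_missed_trans (W : {set T}) u v w :
    u \in W -> v \in W -> w \in W ->
    (exists2 n, max_matching W n & n w = w) ->
  never_both_missed W u w -> never_both_missed W w v -> never_both_missed W u v.
Proof.
move=> uW vW wW [n0 n0max n0w] uw wv.
have [->|nuw] := eqVneq u w; first by [].
have [<-|nwv] := eqVneq w v; first by [].
rewrite /never_both_missed; case: (altP (u =P v)) => //= uv.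
apply/forallP=> m; apply/implyP=> mmax; apply/negP=> /andP[/eqP mu /eqP mv].
pose P (n : {ffun T -> T}) := max_matching W n && (n w == w).
pose agree (n : {ffun T -> T}) := [set x | m x == n x].
have P0 : P n0 by rewrite /P n0max n0w eqxx.
case: (@arg_maxnP _ n0 P (fun n => #|agree n|) P0) => n /andP[nmax /eqP nw] Hagree.
have nu : n u != u by apply/eqP=> nu; apply: never_both_missedP uw nuw nmax nu nw.
have nv : n v != v by apply/eqP=> nv; apply: never_both_missedP wv nwv nmax nw nv.
have [mm _] := max_matchingP _ _ mmax; have [nn Hn] := max_matchingP _ _ nmax.
have [mK mh] := matchingP _ _ mm; have [nK nh] := matchingP _ _ nn.
have cuv : 2 <= #|missed W m :\: missed W n|.
  rewrite -[2]/(true.+1) -uv -cards2; apply: subset_leq_card.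
  by apply/subsetP=> x; rewrite !inE => /orP[]/eqP->; rewrite ?uW ?vW ?nu ?nv ?mu ?mv /=.
have [x] : exists x, x \in (missed W n :\: missed W m) :\ w.
  apply/set0Pn; rewrite -card_gt0; move: cuv.
  rewrite cardsD setIC (max_matching_card mmax nmax) -cardsD (cardsD1 w).
  by case: (_ \in _) => // /ltnW.
rewrite !inE => /and3P[xw + /andP[xW /eqP nx]]; rewrite xW /= => mx.
have [hxy _] := mh x mx; have yW : m x \in W := matching_in mm mx.
set y := m x in mx hxy yW; have xy : x != y by rewrite eq_sym.
have ny : n y != y.
  apply/eqP=> ny.
  by have := never_both_missedP (never_both_missed_edge xW yW hxy) xy nmax nx ny.
have n'm := exchange_matching nn nx hxy xy xW yW; set n' := exchange n x y in n'm.
have nyx : n y != x by apply: contraNneq xy => E; rewrite -(inj_eq (inv_inj nK)) E nx.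
have n'max : max_matching W n'.
  apply/max_matchingP; split=> // m' mm'; apply: leq_trans (Hn _ mm').
  rewrite (cardsD1 x (missed W n)) inE xW nx eqxx /= add1n.
  apply: leq_trans (_ : #|n y |: (missed W n :\ x)| <= _); last first.
    by rewrite cardsU1 -[X in _ <= X]add1n leq_add2r leq_b1.
  apply/subset_leq_card/subsetP=> a; rewrite !inE ffunE => /andP[->].
  have [->|_] := eqVneq a x; first by rewrite eq_sym (negPf xy).
  have [->|_] := eqVneq a y; first by rewrite (negPf xy).
  by have [//|_] := eqVneq a (n y).
have n'w : n' w = w.
  rewrite ffunE eq_sym (negPf xw); have [E|_] := eqVneq w y; last by case: ifP.
  by move: ny; rewrite -E nw eqxx.
have /Hagree : P n' by rewrite /P n'max n'w eqxx.
rewrite /geq /= leqNgt => /negP; apply.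
apply: proper_card; apply/properP; split.
  apply/subsetP=> a; rewrite !inE ffunE => /eqP Ea.
  have [->|_] := eqVneq a x; first by rewrite eqxx.
  have [->|_] := eqVneq a y; first by rewrite mK eqxx.
  have [E|_] := eqVneq a (n y); last by rewrite Ea.
  move: Ea; rewrite E nK => Ea; move: nyx; rewrite -(inj_eq (inv_inj mK)) Ea.
  by rewrite eqxx.
by exists x; rewrite inE ?ffunE ?eqxx //= nx eq_sym.
Qed.

(** Induction on [W]. If every vertex is missed by some maximum matching, Gallai's lemma gives
    classes that serve as labels, with [Y] empty. Otherwise a vertex covered by all maximum
    matchings is deleted and put into [Y]. *)
Theorem Tutte_Berge (W : {set T}) :
  exists (m : {ffun T -> T}) (Y : {set T}) (lab : T -> {set T}),
    [/\ matching W m, Y \subset W, label_closed (W :\: Y) lab &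
        #|missed W m| + #|Y| <= #|odd_labels (W :\: Y) lab|].
Proof.
have [k] := ubnP #|W|; elim: k W => // k IH W ltWk.
have [/existsP[v /andP[vW /forallP vcov]]|/existsPn nocov] :=
  boolP [exists v in W, [forall m : {ffun T -> T}, max_matching W m ==> (m v != v)]];
  last first.
  have unm w : w \in W -> exists2 n, max_matching W n & n w = w.
    move=> wW; move: (nocov w); rewrite wW /= negb_forall => /existsP[n].
    by rewrite negb_imply negbK => /andP[? /eqP]; exists n.
  have [m mmax] := max_matching_exists W.
  pose lab u := [set v in W | never_both_missed W u v].
  have labP u v : u \in W -> v \in W -> (lab u == lab v) = never_both_missed W u v.
    move=> uW vW; apply/eqP/idP => [E|uv].
      have : v \in lab v by rewrite inE vW /never_both_missed eqxx.
      by rewrite -E inE vW.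
    apply/setP=> x; rewrite !inE; case xW: (x \in W) => //=.
    apply/idP/idP; last by apply: never_both_missed_trans => //; apply: unm.
    rewrite never_both_missed_sym in uv.
    by apply: never_both_missed_trans => //; apply: unm.
  have [mm _] := max_matchingP _ _ mmax; have [mK mh] := matchingP _ _ mm.
  exists m, set0, lab; rewrite setD0 sub0set cards0 addn0; split=> //.
    by move=> x y xW yW hxy; apply/eqP; rewrite labP ?never_both_missed_edge.
  (* Distinct missed vertices lie in distinct classes, and the class of a missed vertex is odd
     because [m] pairs up its other vertices. *)
  rewrite -(@card_in_imset _ _ lab (missed W m)); last first.
    move=> u v; rewrite !inE => /andP[uW /eqP mu] /andP[vW /eqP mv] /eqP.
    rewrite labP // => uv; apply/eqP/negPn/negP=> nuv.
    exact: never_both_missedP uv nuv mmax mu mv.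
  apply: subset_leq_card; apply/subsetP=> _ /imsetP[u + ->].
  rewrite !inE => /andP[uW /eqP mu].
  set K := [set x in W | _]; have uK : u \in K by rewrite inE uW eqxx.
  rewrite (cardsD1 u) uK add1n /=; apply: (involution_even_card mK) => x; rewrite !inE.
    case/and3P=> xu xW /eqP xl.
    have [->|mx] := eqVneq (m x) x; first by rewrite xu xW xl eqxx.
    have mxW := matching_in mm mx; rewrite mxW -xl labP // never_both_missed_sym.
    rewrite never_both_missed_edge ?andbT //; last by case: (mh x mx).
    by rewrite -{1}mu (inj_eq (inv_inj mK)).
  case/and3P=> xu xW /eqP/esym/eqP; rewrite labP // => xl; apply/eqP=> mx.
  by rewrite eq_sym in xu; apply: never_both_missedP xl xu mmax mu mx.
have cW : #|W| = (#|W :\ v|).+1 by rewrite (cardsD1 v) vW.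
have [|m' [Y [lab [mm' sY cl le]]]] := IH (W :\ v); first by rewrite -ltnS -cW.
have [m mmax] := max_matching_exists W; have [mm Hm] := max_matchingP _ _ mmax.
have [m'K m'h] := matchingP _ _ mm'.
have m'm : matching W m'.
  by apply/matchingP; split=> // x /m'h[]; rewrite inE => ? /andP[].
have m'v : m' v = v.
  by apply/eqP/negPn/negP=> /m'h[_]; rewrite !inE eqxx.
have cm' : #|missed W m'| = (#|missed (W :\ v) m'|).+1.
  rewrite (cardsD1 v) inE vW m'v eqxx add1n; congr _.+1; apply: eq_card => x.
  by rewrite !inE andbA.
have lt : #|missed W m| < #|missed W m'|.
  rewrite ltnNge; apply/negP=> ge; have : max_matching W m'.
    by apply/max_matchingP; split=> // n /Hm; apply: leq_trans.
  by move/(implyP (vcov m')); rewrite m'v eqxx.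
(* Equal parity widens the strict inequality to a gap of two: one unit is [v] itself, missed by
   [m'], and the other pays for adding [v] to [Y]. *)
have par : odd #|missed W m| = odd #|missed W m'| by rewrite !missed_parity.
have vY : v \notin Y by apply: contraTN vW => /(subsetP sY); rewrite !inE eqxx.
have WY : W :\: (v |: Y) = W :\ v :\: Y by rewrite setDDl.
exists m, (v |: Y), lab; rewrite WY cardsU1 vY; split=> //; last first.
  by apply: leq_trans le; rewrite addnA leq_add2r addn1; move: lt par; rewrite cm' /=;
     clear; set a := #|missed W m|; set b := #|_|; lia.
by rewrite subUset sub1set vW (subset_trans sY) ?subsetDl.
Qed.

End TutteBerge.

(** * Packing odd paths *)

Lemma card_le_fibers (aT rT : finType) (f : aT -> rT) (A : {set aT}) (n : nat) :
  (forall y, #|[set x in A | f x == y]| <= n) -> #|A| <= n * #|f @: A|.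
Proof.
move=> fib; rewrite -sum1_card (partition_big_imset f) /= mulnC -sum_nat_const.
apply: leq_sum => y _; apply: leq_trans (fib y); rewrite sum1dep_card.
by apply: subset_leq_card; apply/subsetP=> x; rewrite !inE.
Qed.

(** * Orbits of an injective map *)

Section Orbits.

Variables (T : finType) (f : T -> T).
Hypothesis f_inj : injective f.

Lemma iter_fix_order x n : iter n f x = x -> fingraph.order f x %| n.
Proof.
set k := fingraph.order f x.
have itk m : iter (m * k) f x = x by elim: m => // m IH; rewrite mulSn iterD IH iter_order.
rewrite {1}(divn_eq n k) addnC iterD itk => E.
have ltk : n %% k < k by rewrite ltn_mod; apply: order_gt0.
by rewrite /dvdn; have := findex_iter ltk; rewrite E findex0 => <-.
Qed.

Lemma order_iter x n : fingraph.order f (iter n f x) = fingraph.order f x.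
Proof.
apply: eq_card => y; rewrite !inE; apply/esym/same_connect; last exact: fconnect_iter.
exact: fconnect_sym.
Qed.

End Orbits.

Section OddPaths.

Variables (T : finType) (e : rel T) (S : {set T}).

Definition odd_path (x : T) (q : seq T) : bool :=
  [&& path e x q, uniq (x :: q), odd (size q), x \in S, last x q \in S &
      all (fun y => (y \in S) ==> (y == last x q)) q].

Definition odd_path_packing (l : nat) (x : 'I_l -> T) (q : 'I_l -> seq T) : Prop :=
  (forall i, odd_path (x i) (q i)) /\
  (forall i j z, z \in x i :: q i -> z \in x j :: q j -> i = j).

Hypothesis e_sym : symmetric e.
Hypothesis e_irr : irreflexive e.

(* Matchings of the graph [double] on [double_set] (two copies of V \ S, one copy of S)
   that exceed the matching {(v, true), (v, false)} correspond to odd S-paths. *)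
Definition double : rel (T * bool) := fun u v =>
  if u.1 == v.1 then u.2 != v.2 else e u.1 v.1 && (u.2 == v.2).

Definition double_set : {set T * bool} := [set u | u.2 || (u.1 \notin S)].

Lemma double_sym : symmetric double.
Proof. by move=> u v; rewrite /double eq_sym e_sym [u.2 == _]eq_sym. Qed.

Lemma card_double_set : #|double_set| + #|S| = 2 * #|T|.
Proof.
rewrite (_ : double_set = ~: setX S [set false]).
  have := cardsC (setX S [set false]).
  by rewrite cardsX cards1 muln1 card_prod card_bool addnC mulnC.
by apply/setP=> -[v b]; rewrite !inE negb_and orbC; case: b.
Qed.

Section Augmenting.

Variable m : {ffun T * bool -> T * bool}.
Hypothesis mm : matching double double_set m.

Let mK : involutive m := proj1 (matchingP _ _ _ mm).
Let mh := proj2 (matchingP _ _ _ mm).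

(** [flip] is the standard matching of the two copies of each vertex outside [S], so [alternate]
    walks along the symmetric difference of it and [m], two edges at a time. *)
Definition flip (u : T * bool) : T * bool := if u.1 \in S then u else (u.1, ~~ u.2).
Definition alternate (u : T * bool) : T * bool := flip (m u).

Lemma flipK : involutive flip.
Proof.
by case=> v b; rewrite /flip /=; case vS: (v \in S); rewrite /= vS ?negbK.
Qed.

Lemma flip_fix u : (flip u == u) = (u.1 \in S).
Proof.
case: u => v b; rewrite /flip /=; case: ifP => _; rewrite ?eqxx //.
by rewrite xpair_eqE eqxx; case: b.
Qed.

Lemma alternate_inj : injective alternate.
Proof. exact: inj_comp (inv_inj flipK) (inv_inj mK). Qed.

Lemma iter_alternate_inj j : injective (iter j alternate).
Proof. by elim: j => // j IH x y /alternate_inj/IH. Qed.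

(** Both factors of [alternate] are involutions, so [flip] conjugates it to its inverse. *)
Lemma iter_flip_iter j x : iter j alternate (flip (iter j alternate x)) = flip x.
Proof.
elim: j x => // j IH x; rewrite [in LHS]iterSr iterS {2}/alternate flipK.
by rewrite /alternate mK -/alternate IH.
Qed.

Lemma double_setP u : u \in double_set -> u.1 \in S -> u.2.
Proof. by rewrite inE => /orP[|/negP]. Qed.

Lemma iter_double_set j x : x \in double_set -> iter j alternate x \in double_set.
Proof.
move=> xW; elim: j => //= j; set u := iter j _ _ => uW.
have muW : m u \in double_set.
  by have [->|mu] := eqVneq (m u) u; [|exact: matching_in mm mu].
rewrite /alternate /flip; case: ifP => // /negbT vS.
by rewrite inE vS orbT.
Qed.

Lemma eq_fst u v : u \in double_set -> v \in double_set -> u.1 = v.1 ->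
  u = v \/ u = flip v.
Proof.
case: u v => [u a] [v b] uW vW /= uv; subst v.
case uS: (u \in S).
  by have /= -> := double_setP uW uS; have /= -> := double_setP vW uS; left.
rewrite /flip /= uS; have [->|ab] := eqVneq a b; first by left.
by right; case: (a) (b) ab => [] [].
Qed.

Variable s : T.
Hypothesis sS : s \in S.

Let x0 := (s, true).
Let k := fingraph.order alternate x0.
Let X j := iter j alternate x0.

Lemma flip_start : flip x0 = x0.
Proof. by rewrite /flip sS. Qed.

Lemma orbit_double_set j : X j \in double_set.
Proof. by apply: iter_double_set; rewrite inE. Qed.

(** [flip] sends [X j] to [X (-j)], indices modulo [k]. If [k = 2h + 1], then
    [flip (X h) = X (h + 1) = flip (m (X h))], so [m] fixes [X h]. *)
Lemma odd_orbit_missed : odd k -> X k./2 \in missed double_set m.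
Proof.
move=> kodd; rewrite inE orbit_double_set /=.
have : alternate (X k./2) = flip (X k./2).
  apply: (@iter_alternate_inj k./2); rewrite iter_flip_iter flip_start.
  rewrite -iterS -iterD addnS addnn -[_.+1]/(true + k./2.*2) -kodd odd_double_half.
  exact: iter_order alternate_inj _.
by move/(inv_inj flipK)->.
Qed.

Section EvenOrbit.

Hypothesis k_even : ~~ odd k.
Let i := k./2.
Let k2 : k = i.*2. Proof. by rewrite -[LHS]odd_double_half (negPf k_even). Qed.
Let i_gt0 : 0 < i. Proof. by rewrite -double_gt0 -k2; apply: order_gt0. Qed.

(** A fixed point [X j] of [m] would give [flip (X j) = X (j + 1)], so the even number [k] would
    divide [2j + 1]. *)
Lemma even_orbit_unmissed j : m (X j) != X j.
Proof.
apply/eqP=> E; have : iter (j.*2.+1) alternate x0 = x0.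
  rewrite -addnn -addnS iterD iterS -/(X j) /alternate E -/alternate iter_flip_iter.
  exact: flip_start.
move/(iter_fix_order alternate_inj); rewrite -/k k2 => d.
have : 2 %| j.*2.+1 by apply: dvdn_trans d; rewrite -muln2 dvdn_mull.
by rewrite dvdn2 /= odd_double.
Qed.

(** If [m] joined the two copies of one vertex, [alternate] would fix [X j] and [k] would divide 1.
    So the edge of [m] comes from an edge of [e] and stays within one copy. *)
Lemma even_orbit_edge j :
  e (X j).1 (X j.+1).1 /\ (m (X j)).2 = (X j).2.
Proof.
have [+ _] := mh (even_orbit_unmissed j); have mW := matching_in mm (even_orbit_unmissed j).
have -> : (X j.+1).1 = (m (X j)).1 by rewrite /X iterS /alternate /flip; case: ifP.
rewrite /double; case: eqP => [E|_]; last by case/andP=> ? /eqP.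
case: (eq_fst mW (orbit_double_set j) (esym E)) => [Em|Em _].
  by move: (even_orbit_unmissed j); rewrite Em eqxx.
have : iter j alternate (alternate x0) = iter j alternate x0.
  by rewrite -iterSr iterS -/(X j) /alternate Em flipK.
move/iter_alternate_inj=> /(@iter_fix_order _ _ alternate_inj x0 1).
by rewrite -/k k2 dvdn1 => /eqP; case: (i) => // ?; rewrite doubleS.
Qed.

Lemma even_orbit_distinct j j' : j < j' <= i -> (X j).1 != (X j').1.
Proof.
case/andP=> jj' j'i; apply/eqP=> E.
have [] := eq_fst (orbit_double_set j) (orbit_double_set j') E.
  rewrite -(subnK (ltnW jj')) /X addnC iterD => /iter_alternate_inj/esym.
  move/(iter_fix_order alternate_inj); rewrite -/k k2 => /dvdn_leq; rewrite subn_gt0 => /(_ jj').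
  by rewrite -addnn; lia.
move=> Ef; have : iter (j' + j) alternate x0 = x0.
  by rewrite iterD -/(X j) Ef iter_flip_iter flip_start.
move/(iter_fix_order alternate_inj); rewrite -/k k2 => /dvdn_leq; rewrite -addnn; lia.
Qed.

Lemma even_orbit_in_S j : (X j).1 \in S -> i %| j.
Proof.
rewrite -flip_fix => /eqP E; have : iter (j + j) alternate x0 = x0.
  by rewrite iterD -/(X j) -E iter_flip_iter flip_start.
move/(iter_fix_order alternate_inj); rewrite -/k k2 addnn -!mul2n.
by rewrite dvdn_pmul2l.
Qed.

Lemma even_orbit_half_in_S : (X i).1 \in S.
Proof.
rewrite -flip_fix; apply/eqP; apply: (@iter_alternate_inj i).
rewrite iter_flip_iter flip_start -iterD addnn -k2; apply/esym.
exact: iter_order alternate_inj _.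
Qed.

(** Edges of [m] keep the copy and [flip] changes it outside [S], which the orbit avoids strictly
    between its start and [X i]. *)
Lemma even_orbit_snd j : j < i -> (X j).2 = ~~ odd j.
Proof.
elim: j => // j IH lt; have [_ E] := even_orbit_edge j.
rewrite /X iterS /alternate -/(X j) /flip; case: ifP => vS.
  have : i %| j.+1.
    by apply: even_orbit_in_S; rewrite /X iterS /alternate -/(X j) /flip vS.
  by move/dvdn_leq => /(_ isT); rewrite leqNgt lt.
by rewrite /= E IH // ltnW.
Qed.

(** [X i] projects into [S], whose vertices have only the copy [true]. As [m] keeps the copy,
    [X (i - 1)] has copy [true] as well, so [i - 1] is even. *)
Lemma even_orbit_half_odd : odd i.
Proof.
have [j Ej] : exists j, i = j.+1 by exists i.-1; rewrite prednK.
have [_ E] := even_orbit_edge j; have iS := even_orbit_half_in_S; move: iS.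
rewrite Ej /X iterS /alternate -/(X j) => iS.
have mS : (m (X j)).1 \in S.
  by move: iS; rewrite /flip; case: ifP => //= ->.
have := double_setP (matching_in mm (even_orbit_unmissed j)) mS.
by rewrite E even_orbit_snd ?Ej //= => ->.
Qed.

(* [flip] fixes the start of the orbit and hence reverses the orbit; when the length is even, its
   midpoint is the only other point fixed by [flip], that is, the other end in [S]. *)
Definition orbit_path : seq T := mkseq (fun j => (X j.+1).1) i.

Lemma orbit_pathE : s :: orbit_path = mkseq (fun j => (X j).1) i.+1.
Proof.
by rewrite /orbit_path /mkseq /= -[iota 1 i]/(iota (1 + 0) i) iotaDl -map_comp.
Qed.

Lemma orbit_path_last : last s orbit_path = (X i).1.
Proof.
rewrite -[last s _]/(last s (s :: orbit_path)) orbit_pathE -nth_last size_mkseq.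
by rewrite nth_mkseq.
Qed.

Lemma orbit_path_odd : odd_path s orbit_path.
Proof.
apply/and5P; split=> //.
- apply/(pathP s) => j; rewrite orbit_pathE size_mkseq => lt.
  rewrite !nth_mkseq //; last exact: ltnW.
  by case: (even_orbit_edge j).
- rewrite orbit_pathE; apply/mkseq_uniqP=> j j' /=; rewrite !inE !ltnS => ji j'i E.
  case: (ltngtP j j') => // lt.
    by have := @even_orbit_distinct j j'; rewrite lt j'i E eqxx => /(_ isT).
  by have := @even_orbit_distinct j' j; rewrite lt ji E eqxx => /(_ isT).
- by rewrite size_mkseq even_orbit_half_odd.
rewrite orbit_path_last even_orbit_half_in_S /=.
apply/allP=> y /mapP[j]; rewrite mem_iota add0n => /andP[_ ji] ->.
apply/implyP=> /even_orbit_in_S/(dvdn_leq (ltn0Sn j)) le.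
by rewrite (_ : j.+1 = i) //; apply/eqP; rewrite eqn_leq ji.
Qed.

Lemma orbit_in_S j : j < k -> (X j).1 \in S -> X j \in [set x0; X i].
Proof.
move=> jk /even_orbit_in_S/dvdnP[c Ec]; rewrite Ec k2 in jk *.
rewrite -mul2n ltn_pmul2r // in jk.
by case: c jk {Ec} => [|[|]] // _; rewrite !inE ?mul0n ?mul1n eqxx ?orbT.
Qed.

End EvenOrbit.

Lemma orbit_path_mem z : z \in s :: orbit_path ->
  exists2 u, u.1 = z & fconnect alternate x0 u /\ u \in double_set.
Proof.
rewrite orbit_pathE => /mapP[j _ ->]; exists (X j) => //; split.
  exact: fconnect_iter.
exact: orbit_double_set.
Qed.

End Augmenting.

(** Every vertex of [S] starts an orbit. The midpoints of odd orbits are distinct missed vertices,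
    and an even orbit contains at most two vertices of [S]; hence at least [l] even orbits occur,
    and each yields a path. *)
Lemma packing_of_matching (m : {ffun T * bool -> T * bool}) (l : nat) :
  matching double double_set m -> #|missed double_set m| + 2 * l <= #|S| ->
  exists x q, @odd_path_packing l x q.
Proof.
move=> mm le; have alt_inj := alternate_inj mm.
pose alt := alternate m; pose ord s := fingraph.order alt (s, true).
pose E := [set s in S | ~~ odd (ord s)].
pose orb s := [set u | fconnect alt (s, true) u].
have oddE : #|S :\: E| <= #|missed double_set m|.
  pose g s := iter (ord s)./2 alt (s, true).
  rewrite -(@card_in_imset _ _ g); last first.
    move=> s s'; rewrite !inE => /andP[H sS] /andP[H' s'S] gE.
    have od : ord s = ord s'.
      by rewrite /ord -(order_iter alt_inj _ (ord s)./2) -/(g s) gE (order_iter alt_inj).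
    have := iter_flip_iter mm (ord s)./2 (s, true).
    rewrite -/(g s) gE od (iter_flip_iter mm) !flip_start //.
    by case.
  apply: subset_leq_card; apply/subsetP=> _ /imsetP[s + ->].
  rewrite !inE => /andP[+ sS]; rewrite sS /= negbK => sodd.
  by have := odd_orbit_missed mm sS sodd; rewrite !inE.
(* By [orbit_in_S] an even orbit meets [S] only at its start and its midpoint. *)
have fib : #|E| <= 2 * #|orb @: E|.
  apply: card_le_fibers => O.
  have [->|[s]] := set_0Vmem [set x in E | orb x == O]; first by rewrite cards0.
  rewrite !inE => /andP[/andP[sS sev] /eqP sO].
  pose i := (ord s)./2.
  apply: leq_trans (_ : #|[set s; (iter i alt (s, true)).1]| <= _); last first.
    by rewrite cards2; case: (_ != _).
  apply: subset_leq_card; apply/subsetP=> s'; rewrite !inE -sO => /andP[/andP[s'S _] /eqP oE].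
  have : (s', true) \in orb s by rewrite -oE inE connect0.
  rewrite inE => /iter_findex E'; have := findex_max.
  move=> /(_ _ alt (s, true) (s', true)); have : (s', true) \in orb s by rewrite -oE inE connect0.
  rewrite inE => c /(_ c) lt.
  have := orbit_in_S mm sS sev lt; rewrite E' /= => /(_ s'S).
  rewrite !inE => /orP[/eqP[->]|/eqP E2]; first by rewrite eqxx.
  by apply/orP; right; apply/eqP; rewrite -/alt -/(ord s) -/i in E2; rewrite -E2.
have lE : l <= #|orb @: E|.
  have EI : S :&: E = E by apply/setIidPr/subsetP=> s; rewrite inE => /andP[].
  have := cardsID E S; rewrite EI.
  move: le oddE fib; clear.
  set a := #|missed _ _|; set b := #|S|; set c := #|S :\: E|; set d := #|E|.
  set f := #|_|; lia.
have /fin_all_exists[x Hx] (i : 'I_l) : exists s, s \in E /\ orb s = enum_val (widen_ord lE i).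
  by have /imsetP[s sE ->] := enum_valP (widen_ord lE i); exists s.
have xE i : x i \in S /\ ~~ odd (ord (x i)).
  by case: (Hx i); rewrite inE => /andP[].
exists x, (fun i => orbit_path m (x i)); split=> [i|i j z].
  by case: (xE i) => ? ?; apply: orbit_path_odd.
case/(orbit_path_mem mm)=> u uz [uc uW].
case/(orbit_path_mem mm)=> v vz [vc vW].
have csym := fconnect_sym alt_inj.
(* Copies of one vertex are equal or exchanged by [flip], which maps the orbit of a vertex of [S] to
   itself. *)
have c : fconnect alt (x i, true) (x j, true).
  rewrite csym in vc; have [Euv|Euv] := eq_fst uW vW (etrans uz (esym vz)).
    by rewrite Euv in uc; apply: connect_trans uc vc.
  move: (vc); rewrite csym => /iter_findex Ev.
  have := iter_flip_iter mm (findex alt (x j, true) v) (x j, true).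
  rewrite Ev -Euv flip_start ?(proj1 (xE j)) // => Eu.
  by apply: connect_trans uc _; rewrite -Eu; apply: fconnect_iter.
have : orb (x i) = orb (x j).
  by apply/setP=> y; rewrite !inE; apply: same_connect.
rewrite (proj2 (Hx i)) (proj2 (Hx j)) => /enum_val_inj/(congr1 val) /= E'.
exact: val_inj.
Qed.

(* Take a Tutte-Berge certificate [Y] of the auxiliary graph.  The vertices with exactly one copy
   outside [Y] are 2-coloured by that copy, and an edge between two of them of equal colour, or
   two attachments of the same piece, share a label: keep one such vertex per label in [U], and
   put the others into [X] together with the vertices having no copy outside [Y]. *)
Lemma packing_or_decomposition (k : nat) :
  (exists x q, @odd_path_packing k.+1 x q) \/
  exists (X U : {set T}) (c : T -> bool) (L : finType) (lab : T -> L) (a : L -> {set T}),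
    [/\ [/\ #|X| <= 2 * k, S :\: X \subset U & [disjoint X & U]],
        forall u v, u \in U -> v \in U -> e u v -> c u != c v,
        label_closed e (~: (X :|: U)) lab,
        forall w v, w \notin X :|: U -> v \in U -> e w v -> v \in a (lab w) &
        forall y, a y \subset U /\ #|a y| <= 1].
Proof.
have [m [Y [lab [mm sY cl le]]]] := Tutte_Berge double_sym double_set.
have par : odd #|missed double_set m| = odd #|S|.
  rewrite (missed_parity mm); have := congr1 odd card_double_set.
  by rewrite oddD mul2n odd_double; do 2!case: (odd _).
case: (leqP (#|missed double_set m| + 2 * k.+1) #|S|) => [leS|ltS].
  by left; apply: packing_of_matching mm leS.
right; have [D DE] : exists D, D = double_set :\: Y by exists (double_set :\: Y).
rewrite -!DE in cl le.
have SD v : v \in S -> (v, false) \notin D by move=> vS; rewrite DE !inE vS /= andbF.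
(* Vertices are sorted by the number of their copies in [D]: two, one or none. A vertex of [S] is
   never in [full]. *)
pose full := [set v | ((v, true) \in D) && ((v, false) \in D)].
pose half := [set v | ((v, true) \in D) (+) ((v, false) \in D)].
pose none := [set v | ((v, true) \notin D) && ((v, false) \notin D)].
pose b v := (v, true) \in D.
pose hlab v := lab (v, b v).
pose rep y := [pick u in half | hlab u == y].
pose U := [set u in half | rep (hlab u) == Some u].
have bD v : v \in half -> (v, b v) \in D.
  by rewrite inE /b; case E: ((v, true) \in D) => //= ->.
have fullD v c : v \in full -> (v, c) \in D by rewrite inE => /andP[]; case: c.
have full_lab v c : v \in full -> lab (v, c) = lab (v, true).
  by move=> vf; case: c => //; apply: cl; rewrite ?fullD // /double eqxx.
have cross u v c : (u, c) \in D -> (v, c) \in D -> e u v -> lab (u, c) = lab (v, c).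
  move=> uD vD uv; apply: cl => //; rewrite /double /= uv eqxx.
  by case: eqP uv => // ->; rewrite e_irr.
have UP u : (u \in U) = (u \in half) && (rep (hlab u) == Some u) by rewrite inE.
(* A vertex of [full] has both copies in the same class, so an odd class must contain the copy of a
   vertex of [half], and then has a representative in [U]. *)
have oddU : #|odd_labels D lab| <= #|U|.
  apply: leq_trans (leq_imset_card hlab _); apply/subset_leq_card/subsetP=> y.
  rewrite inE => yodd; have [v /andP[vh vy]] : exists v, (v \in half) && (hlab v == y).
    apply/existsP; apply: contraLR yodd; rewrite negb_exists => /forallP nov.
    have flK : involutive (fun u : T * bool => (u.1, ~~ u.2)).
      by case=> v c; rewrite /= negbK.
    apply: (involution_even_card flK) => -[v c]; last by rewrite xpair_eqE eqxx; case: (c).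
    have := nov v; rewrite !inE => nv /andP[vD vy].
    have vf : v \in full.
      rewrite inE; apply: contraR nv; move: vD; rewrite /hlab /b.
      by case: c vy => vy; case: ((v, true) \in D) vy; case: ((v, false) \in D) => //= ->.
    by rewrite fullD // full_lab // -(full_lab v c vf).
  case Er: (rep y) => [u|]; last first.
    by move: Er; rewrite /rep; case: pickP => [//|/(_ v)] /=; rewrite vh vy.
  have /andP[uh uy] : (u \in half) && (hlab u == y).
    by move: Er; rewrite /rep; case: pickP => // u' ? [<-].
  by apply/imsetP; exists u; rewrite ?UP ?uh (eqP uy) ?Er ?eqxx.
pose Dt := [set v | (v, true) \in D]; pose Df := [set v | (v, false) \in D].
have cD : #|D| = #|Dt| + #|Df|.
  rewrite -(cardsID [set u | u.2] D); congr (_ + _).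
    rewrite -(card_imset Dt (_ : injective (fun v => (v, true)))); last by move=> ? ? [].
    apply: eq_card => -[v c]; rewrite !inE /=; apply/idP/imsetP => [/andP[vD]|[v' + [-> ->]]].
      by case: c vD => // vD _; exists v; rewrite ?inE.
    by rewrite !inE => ->.
  rewrite -(card_imset Df (_ : injective (fun v => (v, false)))); last by move=> ? ? [].
  apply: eq_card => -[v c]; rewrite !inE /=; apply/idP/imsetP => [/andP[]|[v' + [-> ->]]].
    by case: c => // _ vD; exists v; rewrite ?inE.
  by rewrite !inE => ->.
have cTf : #|Dt| + #|Df| = 2 * #|full| + #|half|.
  rewrite -cardsUI (_ : Dt :&: Df = full); last by apply/setP=> v; rewrite !inE.
  rewrite -(cardsID full (Dt :|: Df)) (_ : _ :&: full = full); last first.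
    by apply/setP=> v; rewrite !inE; do 2!case: (_ \in D).
  rewrite (_ : _ :\: full = half); last first.
    by apply/setP=> v; rewrite !inE; do 2!case: (_ \in D).
  lia.
have cT : #|full| + #|half| + #|none| = #|T|.
  have -> : #|full| + #|half| = #|full :|: half|.
    rewrite cardsU (_ : full :&: half = set0) ?cards0 ?subn0 //.
    by apply/setP=> v; rewrite !inE; do 2!case: (_ \in D).
  rewrite (_ : none = ~: (full :|: half)) ?cardsC //.
  by apply/setP=> v; rewrite !inE; do 2!case: (_ \in D).
have cY : #|D| + #|Y| = #|double_set|.
  by rewrite DE cardsD (setIidPr sY) subnK // subset_leq_card.
have Uh : U \subset half by apply/subsetP=> u; rewrite UP => /andP[].
have outP w : w \notin (none :|: (half :\: U)) :|: U -> w \in full.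
  by rewrite !inE; case: (rep _ == _); do 2!case: (_ \in D).
exists (none :|: (half :\: U)), U, b, _, (fun w => lab (w, true)).
exists (fun y => [set u in U | hlab u == y]); split.
- split.
  (* Counting the copies missing from [D] gives [2|none| + |half| = |S| + |Y|]. The certificate
     gives [|missed| + |Y| <= |U|], and parity improves [ltS] to [|S| <= |missed| + 2k]. Hence
     [2|none| + |half| - |U| <= 2k]. *)
  + apply: leq_trans (leq_card_setU _ _) _; rewrite cardsD (setIidPr Uh).
    have UhC := subset_leq_card Uh; have := card_double_set.
    move: par ltS le oddU cD cTf cT cY UhC; clear.
    set n1 := #|missed _ _|; set n2 := #|S|; set n3 := #|Y|; set n4 := #|odd_labels _ _|.
    set n5 := #|U|; set n6 := #|D|; set n7 := #|Dt|; set n8 := #|Df|; set n9 := #|full|.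
    set n10 := #|half|; set n11 := #|none|; set n12 := #|T|; set n13 := #|double_set|.
    clearbody n1 n2 n3 n4 n5 n6 n7 n8 n9 n10 n11 n12 n13; clear => par; lia.
  + apply/subsetP=> s; rewrite inE => /andP[+ sS]; have := SD s sS.
    by rewrite !inE; case: (rep _ == _); do 2!case: (_ \in D).
  + by rewrite -setI_eq0; apply/eqP/setP=> v; rewrite !inE;
       case: (rep _ == _); do 2!case: (_ \in D).
- move=> u v; rewrite !UP => /andP[uh /eqP ur] /andP[vh /eqP vr] uv; apply/eqP=> buv.
  have E : hlab u = hlab v.
    by rewrite /hlab buv; apply: cross uv; rewrite -?buv ?bD // buv bD.
  by move: ur; rewrite E vr => -[E']; rewrite E' e_irr in uv.
- move=> u v; rewrite !in_setC => /outP uf /outP vf uv.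
  by apply: cross uv; apply: fullD.
- move=> w v /outP wf vU wv; rewrite inE vU eq_sym -(full_lab w (b v) wf) /hlab.
  by rewrite (cross w v (b v) (fullD _ _ wf) (bD _ (subsetP Uh _ vU)) wv) eqxx.
move=> y; split; first by apply/subsetP=> u; rewrite inE => /andP[].
apply/card_le1_eqP=> u v; rewrite !inE => /andP[/andP[_ /eqP ur] /eqP uy].
by case/andP=> /andP[_ /eqP vr] /eqP vy; move: ur; rewrite uy -vy vr => -[].
Qed.

End OddPaths.

(** * Odd clique minors from a core *)

Definition restrict (T : finType) (A : {set T}) (r : rel T) : rel T :=
  fun x y => [&& x \in A, y \in A & r x y].

Lemma restrict_sym (T : finType) (A : {set T}) (r : rel T) :
  symmetric r -> symmetric (restrict A r).
Proof. by move=> rs x y; rewrite /restrict rs andbCA. Qed.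

(** In a symmetric edge set minimal among those connecting [V], every edge is a bridge: an edge
    whose ends stay connected without it could be deleted in both directions. *)
Lemma spanning_tree (T : finType) (e E0 : rel T) (V : {set T}) :
    (forall x y, E0 x y -> [/\ e x y, x \in V & y \in V]) -> symmetric E0 -> V != set0 ->
    (forall x y, x \in V -> y \in V -> connect E0 x y) ->
  exists2 E, tree_subgraph e V E & subrel E E0.
Proof.
move=> E0V E0sym V0 E0c; pose E_ (F : {set T * T}) : rel T := fun x y => (x, y) \in F.
pose P (F : {set T * T}) := [&& [forall x, forall y, E_ F x y ==> E0 x y],
  [forall x, forall y, E_ F x y == E_ F y x] &
  [forall x in V, forall y in V, connect (E_ F) x y]].
have PP F : reflect [/\ subrel (E_ F) E0, symmetric (E_ F) &
    forall x y, x \in V -> y \in V -> connect (E_ F) x y] (P F).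
  apply: (iffP and3P) => -[Fs Fsym Fc]; split.
  - by move=> x y; move/forallP/(_ x)/forallP/(_ y)/implyP: Fs.
  - by move=> x y; move/forallP/(_ x)/forallP/(_ y)/eqP: Fsym.
  - by move=> x y xV yV; move/forall_inP/(_ x xV)/forall_inP/(_ y yV): Fc.
  - by apply/forallP=> x; apply/forallP=> y; apply/implyP/Fs.
  - by apply/forallP=> x; apply/forallP=> y; apply/eqP/Fsym.
  - by apply/forall_inP=> x xV; apply/forall_inP=> y yV; apply: Fc.
have P0 : P [set u | E0 u.1 u.2].
  have E0E x y : E_ [set u | E0 u.1 u.2] x y = E0 x y by rewrite /E_ inE.
  apply/PP; split=> [x y|x y|x y xV yV]; rewrite ?E0E //.
  by rewrite (eq_connect E0E) E0c.
case: (arg_minnP (fun F : {set T * T} => #|F|) P0) => F /PP[Fs Fsym Fc] Fmin.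
exists (E_ F) => //; split=> //; first by move=> x y /Fs/E0V.
move=> x y Fxy; apply/negP=> cxy.
pose F' := F :\: [set (x, y); (y, x)].
have F'E a b : E_ F' a b = remove_edge (E_ F) x y a b.
  by rewrite /E_ /= !inE !xpair_eqE andbC.
have F'sym : symmetric (E_ F').
  move=> a b; rewrite !F'E /=; congr (_ && ~~ _); first exact: Fsym.
  by rewrite orbC; congr (_ || _); rewrite andbC.
have : P F'.
  apply/PP; split=> // [a b|a b aV bV].
    by rewrite F'E => /andP[/Fs].
  apply: connect_sub (Fc a b aV bV) => {aV bV} {}a {}b Fab.
  have c'xy : connect (E_ F') x y by rewrite (eq_connect F'E).
  have [F'ab|] := boolP (E_ F' a b); first exact: connect1.
  rewrite F'E /remove_edge /= Fab /= negbK => /orP[]/andP[/eqP-> /eqP->] //.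
  by rewrite (sym_connect_sym F'sym).
move/Fmin; apply/negP; rewrite -ltnNge; apply: proper_card.
rewrite properE subsetDl; apply/subsetPn; exists (x, y) => //.
by rewrite !inE eqxx.
Qed.

Lemma first_hit (T : eqType) (r : rel T) (H : pred T) (x : T) (p : seq T) :
    path r x p -> uniq (x :: p) -> H (last x p) ->
  exists p', [/\ path r x p', uniq (x :: p'), H (last x p'),
                 {subset p' <= p} & forall z, z \in belast x p' -> ~~ H z].
Proof.
elim: p x => [|y p IH] x /=; first by move=> _ _ Hx; exists [::].
case/andP=> rxy pp /andP[xN up] Hl; have [Hx|nHx] := boolP (H x).
  by exists [::]; split.
have [p' [pp' up' Hp' sp' bp']] := IH y pp up Hl.
exists (y :: p'); split=> //=.
- by rewrite rxy.
- rewrite [X in _ && X]up' andbT inE; apply: contra xN; rewrite inE => /orP[->//|/sp' ->].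
  by rewrite orbT.
- by move=> z; rewrite !inE => /orP[->//|/sp' ->]; rewrite orbT.
- by move=> z; rewrite inE => /orP[/eqP->|/bp'].
Qed.

Section OddPathTheory.

Variables (T : finType) (e : rel T) (S : {set T}).

Lemma odd_pathP x q :
  reflect ([/\ path e x q, uniq (x :: q), odd (size q), x \in S & last x q \in S] /\
           forall y, y \in x :: q -> y \in S -> y = x \/ y = last x q)
          (odd_path e S x q).
Proof.
apply: (iffP and5P) => [[pq uq oq xS /andP[lS /allP qS]]|[[pq uq oq xS lS] qS]]; split=> //.
  move=> y; rewrite inE => /orP[/eqP->|yq yS]; first by left.
  by right; apply/eqP; move: (qS y yq); rewrite yS.
rewrite lS; apply/allP=> y yq; apply/implyP=> yS.
case: (qS y _ yS) => [|yx|->//]; first by rewrite inE yq orbT.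
by move: uq; rewrite /= -yx yq.
Qed.

Lemma last_rev_belast (x : T) q : last (last x q) (rev (belast x q)) = x.
Proof. by case: q => //= y q; rewrite rev_cons last_rcons. Qed.

Lemma rev_path_seq (x : T) q : last x q :: rev (belast x q) = rev (x :: q).
Proof. by rewrite [in RHS]lastI rev_rcons. Qed.

Lemma odd_path_rev x q : symmetric e ->
  odd_path e S x q -> odd_path e S (last x q) (rev (belast x q)).
Proof.
move=> es /odd_pathP[[pq uq oq xS lS] qS]; apply/odd_pathP; rewrite last_rev_belast.
split=> [|y]; last first.
  by rewrite rev_path_seq mem_rev => yq /(qS y yq)[]; [right|left].
split=> //; last by rewrite size_rev size_belast.
  by rewrite rev_path; under eq_path => a b do rewrite es.
by rewrite rev_path_seq rev_uniq.
Qed.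

End OddPathTheory.

Section Core.

Variables (T : finType) (e : rel T).
Hypothesis e_sym : symmetric e.

Definition bichromatic (c : T -> bool) : rel T := fun x y => e x y && (c x != c y).

Definition core (c : T -> bool) (S : {set T}) (N : nat) (R : 'I_N -> {set T}) : Prop :=
  [/\ forall i j x, x \in R i -> x \in R j -> i = j,
      forall i x, x \in R i -> x \notin S,
      forall x, x \in S -> c x,
      forall i x y, x \in R i -> y \in R i -> connect (restrict (R i) (bichromatic c)) x y &
      forall s i, s \in S -> exists2 r, r \in R i & bichromatic c s r].

Lemma bichromatic_sym c : symmetric (bichromatic c).
Proof. by move=> x y; rewrite /bichromatic e_sym eq_sym. Qed.

Variables (c : T -> bool) (S : {set T}) (N : nat) (R : 'I_N -> {set T}).
Hypothesis coreR : core c S R.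

Definition core_edge : rel T := fun x y =>
  bichromatic c x y && [exists i, (x \in R i :|: S) && (y \in R i :|: S)].

Lemma core_edge_sym : symmetric core_edge.
Proof.
move=> x y; rewrite /core_edge bichromatic_sym; congr (_ && _).
by apply: eq_existsb => i; rewrite andbC.
Qed.

(** The potential that rerouting decreases: the number of edges of the path that are not core
    edges. *)
Fixpoint noncore (x : T) (q : seq T) : nat :=
  if q is y :: q' then ~~ core_edge x y + noncore y q' else 0.

Lemma noncore_cat x p q : noncore x (p ++ q) = noncore x p + noncore (last x p) q.
Proof. by elim: p x => //= y p IH x; rewrite IH addnA. Qed.

Lemma noncore_rev x q : noncore (last x q) (rev (belast x q)) = noncore x q.
Proof.
elim: q x => //= y q IH x; rewrite rev_cons -cats1 noncore_cat IH addnC.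
by rewrite last_rev_belast /= addn0 core_edge_sym.
Qed.

Lemma noncore_path x q : path core_edge x q -> noncore x q = 0.
Proof. by elim: q x => //= y q IH x /andP[-> /IH]. Qed.

Lemma core_edge_in i x y : core_edge x y -> y \in R i -> x \notin S -> x \in R i.
Proof.
have [Rd RS _ _ _] := coreR.
case/andP=> _ /existsP[j]; rewrite !inE => /andP[xj yj] yi /negPf xS.
by move: xj yj; rewrite xS orbF (negPf (RS i y yi)) orbF => xj /(Rd i j y yi) ->.
Qed.

(** Followed backwards from [v], core edges cannot leave [R i] except into [S]; so the vertex
    following [x] is in [R i]. *)
Lemma noncore0_head i x q v :
    noncore x (rcons q v) = 0 -> v \in R i -> (forall y, y \in q -> y \notin S) ->
  head v q \in R i.
Proof.
move=> + vi; case: q => [//|y q] /=; elim: q y x => [|z q IH] y x /= + qS.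
  case xy: (core_edge x y); case yv: (core_edge y v) => // _.
  by apply: core_edge_in yv vi (qS y _); rewrite inE eqxx.
case yz: (core_edge y z); last by case: (core_edge x y).
case xy: (core_edge x y) => // E.
have zi : z \in R i by apply: (IH z y) => [|w wq]; [rewrite yz | apply: qS; rewrite inE wq orbT].
by apply: core_edge_in yz zi (qS y _); rewrite inE eqxx.
Qed.

(** The part of the path before [v] is replaced by core edges from a free vertex [s], so only the
    part after [v] still counts in [noncore]. *)
Lemma shortcut x q1 v q2 s w :
    odd_path e S x (q1 ++ v :: q2) -> v \notin S -> s \in S ->
    s \notin x :: q1 ++ v :: q2 -> path core_edge s w -> last s w = v -> uniq (s :: w) ->
    (forall y, y \in w -> y \notin S) ->
    (forall y, y \in w -> y \in x :: q1 ++ v :: q2 -> y = v) ->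
    odd (size w + size q2) ->
  [/\ odd_path e S s (w ++ q2), noncore s (w ++ q2) = noncore v q2 &
      {subset s :: w ++ q2 <= s :: w ++ x :: q1 ++ v :: q2}].
Proof.
move=> /odd_pathP[[pq uq _ _ lS] qS] vS sS sq pw lw uw wS wv oddw.
have sub : {subset s :: w ++ q2 <= s :: w ++ x :: q1 ++ v :: q2}.
  move=> y; rewrite !(inE, mem_cat).
  by case/or3P=> ->; rewrite ?orbT.
split=> //; last by rewrite noncore_cat noncore_path // lw.
have q2v y : y \in q2 -> y \in x :: q1 ++ v :: q2.
  by move=> yq; rewrite !(inE, mem_cat) yq !orbT.
move: (uq); rewrite -cat_cons cat_uniq => /and3P[_ q12 /= /andP[vq2 uq2]].
apply/odd_pathP; split.
  split=> //; rewrite ?last_cat ?size_cat ?lw //.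
  - rewrite cat_path lw; apply/andP; split.
      by apply: sub_path pw => a b /andP[/andP[]].
    by move: pq; rewrite cat_path => /andP[_ /= /andP[]].
  - rewrite -cat_cons cat_uniq uw uq2 andbT /=; apply/hasPn=> y yq2; rewrite inE.
    apply/norP; split; first by apply: contraNneq sq => <-; apply: q2v.
    by apply: contraNN vq2 => /wv <-//; apply: q2v.
  - by move: lS; rewrite last_cat.
move=> y; rewrite inE mem_cat => /or3P[/eqP->|/wS/negPf->//|yq2 yS]; first by left.
have [yx|->] := qS y (q2v y yq2) yS.
  by move/hasPn: q12 => /(_ y); rewrite inE yq2 orbT yx mem_head => /(_ isT).
by right; rewrite !last_cat lw.
Qed.

Definition near (x : T) (q : seq T) (i : 'I_N) : bool :=
  (head x q \in R i) || (head (last x q) (rev (belast x q)) \in R i).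

(* Rerouting to the free vertex [s] along the first path of the packing met by a walk
   inside [R i] drops an end segment of that path. *)
Lemma reroute l (x : 'I_l -> T) (q : 'I_l -> seq T) (s : T) i :
    odd_path_packing e S x q -> s \in S -> (forall j, s \notin x j :: q j) ->
    (exists j, exists2 z, z \in x j :: q j & z \in R i) ->
    (forall j, ~~ near (x j) (q j) i) ->
  exists x' q', odd_path_packing e S x' q' /\
    \sum_(j < l) noncore (x' j) (q' j) < \sum_(j < l) noncore (x j) (q j).
Proof.
have [Rd RS Sc Rc SR] := coreR.
move=> [xq dis] sS sfree [j0 [z0 z0q z0i]] nonear.
have [r ri sr] := SR s i sS.
pose H y := [exists j, y \in x j :: q j].
have [w0 [pw0 lw0 uw0]] : exists w, [/\ path (restrict (R i) (bichromatic c)) r w,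
    H (last r w) & uniq (r :: w)].
  have /connectP[p pp Ez] := Rc i r z0 ri z0i.
  case/shortenP: pp Ez => p' pp' up' _ Ez; exists p'; split=> //.
  by rewrite -Ez; apply/existsP; exists j0.
(* Stopping at the first vertex of the packing makes the walk disjoint from all paths except at its
   end [v]. *)
have [w1 [pw1 uw1 lw1 _ bw1]] := first_hit pw0 uw0 lw0.
have {w0 pw0 lw0 uw0} w1i y : y \in r :: w1 -> y \in R i.
  rewrite inE => /orP[/eqP->//|]; elim: (w1) (r) pw1 => //= a w IH b /andP[/and3P[_ ai _] pw].
  by rewrite inE => /orP[/eqP->//|]; apply: IH pw.
set v := last r w1 in lw1.
have vi : v \in R i by apply: w1i; apply: mem_last.
have vS := RS _ _ vi.
pose w := r :: w1.
have wS y : y \in w -> y \notin S by move/w1i/RS.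
have pw : path core_edge s w.
  rewrite /= /core_edge sr /=; apply/andP; split.
    by apply/existsP; exists i; rewrite !inE sS ri orbT.
  apply: sub_path pw1 => a b /and3P[ai bi ab]; rewrite /core_edge ab /=.
  by apply/existsP; exists i; rewrite !inE ai bi.
have uw : uniq (s :: w).
  by rewrite cons_uniq uw1 andbT; apply/negP=> /wS; rewrite sS.
have Hw y j : y \in w -> y \in x j :: q j -> y = v.
  rewrite /w lastI mem_rcons inE => /orP[/eqP->//|/bw1/existsPn/(_ j)/negPf->//].
have [j vj] := existsP lw1.
have main x1 q1 : odd_path e S x1 q1 -> x1 :: q1 =i x j :: q j ->
    noncore x1 q1 = noncore (x j) (q j) -> head x1 q1 \notin R i ->
    (exists q2 q3, q1 = q2 ++ v :: q3 /\ odd (size w + size q3)) ->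
  exists x' q', odd_path_packing e S x' q' /\
    \sum_(j < l) noncore (x' j) (q' j) < \sum_(j < l) noncore (x j) (q j).
  move=> o1 m1 n1 h1 [q2 [q3 [E1 oddw]]]; rewrite {}E1 in o1 m1 n1 h1.
  have sN : s \notin x1 :: q2 ++ v :: q3 by rewrite m1 sfree.
  have wv y : y \in w -> y \in x1 :: q2 ++ v :: q3 -> y = v by rewrite m1; apply: Hw.
  have [o' n' sub'] := shortcut o1 vS sS sN pw (erefl : last s w = v) uw wS wv oddw.
  exists (fun k => if k == j then s else x k), (fun k => if k == j then w ++ q3 else q k).
  split; last first.
    rewrite (bigD1 j) // [X in _ < X](bigD1 j) // eqxx.
    rewrite (eq_bigr (fun k => noncore (x k) (q k))); last by move=> k /negPf->.
    rewrite ltn_add2r -n1 n' -cat_rcons noncore_cat last_rcons.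
    rewrite -[X in X < _]add0n ltn_add2r lt0n; apply/eqP=> n0.
    (* If the dropped segment had only core edges, [noncore0_head] would put its second vertex in
       [R i], against [h1]. *)
    have q2S y : y \in q2 -> y \notin S.
      move=> yq2; apply/negP=> yS; have [[_ u1 _ _ _] S1] := odd_pathP _ _ _ _ o1.
      move: u1; rewrite -cat_cons cat_uniq => /and3P[/andP[xq2 _] d23 _].
      case: (S1 y _ yS) => [|Ey|Ey]; first by rewrite inE mem_cat yq2 orbT.
        by rewrite Ey in yq2; rewrite yq2 in xq2.
      rewrite last_cat /= in Ey; move/hasPn: d23 => /(_ y); rewrite {1}Ey mem_last.
      by rewrite inE yq2 orbT => /(_ isT).
    have := noncore0_head n0 vi q2S.
    by move: h1; case: (q2) => [|a q2'] /= /negPf->.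
  have part k z : z \in (if k == j then s else x k) :: (if k == j then w ++ q3 else q k) ->
      z \in x k :: q k \/ (k = j /\ forall k', z \notin x k' :: q k').
    have [->|_] := eqVneq k j; last by left.
    move/sub'; rewrite -[s :: w ++ _]/((s :: w) ++ _) mem_cat m1 => /orP[|->]; last by left.
    have [->|zv] := eqVneq z v; first by left.
    rewrite inE => /orP[/eqP->|zw]; first by right.
    by right; split=> // k'; apply/negP=> /(Hw _ _ zw)/eqP; rewrite (negPf zv).
  split=> [k|k k' z /part zk /part zk'].
    by case: eqP => _.
  case: zk zk' => [zk|[-> zN]] [zk'|[-> zN']] //; first exact: dis zk zk'.
    by move: (zN' k); rewrite zk.
  by move: (zN k'); rewrite zk'.
have [[_ _ oj xS lS] _] := odd_pathP _ _ _ _ (xq j).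
have vq : v \in q j by move: vj; rewrite inE => /orP[/eqP vx|//]; rewrite vx xS in vS.
have /norP[h1 h2] := nonear j.
have [q1 [q2 Eq]] : exists q1 q2, q j = q1 ++ v :: q2.
  by case/splitPr: vq => q1 q2; exists q1, q2.
(* Path [j] has odd length, so its parts on the two sides of [v] have different parities and exactly
   one direction works. *)
case: (boolP (odd (size w + size q2))) => [ow|nw].
  by apply: (main (x j) (q j)) => //; exists q1, q2.
apply: (main (last (x j) (q j)) (rev (belast (x j) (q j)))) => //.
- exact: odd_path_rev.
- by move=> y; rewrite rev_path_seq mem_rev.
- exact: noncore_rev.
case/lastP: q2 Eq nw => [|q2 z] Eq nw.
  by move: lS; rewrite Eq last_cat /= (negPf vS).
exists (rev q2), (rev (x j :: q1)); split.
  by rewrite Eq -rcons_cons -rcons_cat belast_rcons -cat_cons rev_cat rev_cons cat_rcons.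
move: oj nw; rewrite Eq size_cat /= !size_rcons size_rev /=; clear.
by rewrite !addnS /= !negbK !oddD; do 3!case: (odd _).
Qed.

(** Paths meet [S] only in their ends, so [2 * l < #|S|] leaves a vertex free for [reroute]. Since
    [noncore] decreases, the process ends with every piece that is met containing a vertex next to
    an end of some path. *)
Lemma good_packing l (x : 'I_l -> T) (q : 'I_l -> seq T) :
    2 * l < #|S| -> odd_path_packing e S x q ->
  exists x' q', @odd_path_packing T e S l x' q' /\
    forall i j z, z \in x' j :: q' j -> z \in R i ->
      exists j', near (x' j') (q' j') i.
Proof.
move=> ltS; have [n] := ubnP (\sum_(j < l) noncore (x j) (q j)).
elim: n => // n IH in x q * => ltn pk.
pose bad i := [exists j, [exists z in R i, z \in x j :: q j]] &&
  [forall j, ~~ near (x j) (q j) i].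
have [/existsP[i /andP[/existsP[j /exists_inP[z zi zj]] /forallP nn]]|/existsPn ok] :=
  boolP [exists i, bad i]; last first.
  exists x, q; split=> // i j z zj zi; move: (ok i); rewrite negb_and.
  case/orP=> [/existsPn/(_ j)/exists_inPn/(_ z zi)|]; first by rewrite zj.
  by rewrite negb_forall => /existsP[j']; rewrite negbK; exists j'.
have [s sS sfree] : exists2 s, s \in S & forall j, s \notin x j :: q j.
  pose ends (u : 'I_l * bool) := if u.2 then x u.1 else last (x u.1) (q u.1).
  have : ~~ (S \subset ends @: setT).
    apply: contraTN ltS => /subset_leq_card le; rewrite -leqNgt (leq_trans le) //.
    by apply: leq_trans (leq_imset_card _ _) _; rewrite cardsT card_prod card_ord card_bool mulnC.
  case/subsetPn=> s sS sN; exists s => // k; apply: contra sN => sk.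
  have [_ Sk] := odd_pathP _ _ _ _ (proj1 pk k).
  by case: (Sk s sk sS) => ->; apply/imsetP; [exists (k, true)|exists (k, false)].
have [] := reroute pk sS sfree _ nn; first by exists j, z.
move=> x' [q' [pk' lt']]; apply: (IH x' q') => //.
by apply: leq_trans lt' _; rewrite -ltnS.
Qed.

(* Odd paths are coloured alternately from [true] to [false]; the [false] end of each is adjacent to
   a [false] vertex of every piece [R i].  Each path is merged with one unhit piece, and one further
   unhit piece is a branch set of its own. *)
Lemma odd_minor_of_packing l (x : 'I_l -> T) (q : 'I_l -> seq T) :
    2 * l < #|S| -> 3 * l < N -> odd_path_packing e S x q ->
  has_odd_Kt_minor e l.+1.
Proof.
move=> ltS ltN /(good_packing ltS)[{}x [{}q [[xq dis] hit]]].
have [Rd RS Sc Rc SR] := coreR.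
pose hits := [set i | [exists j, [exists z in R i, z \in x j :: q j]]].
(* Each hit piece contains one of the at most [2 * l] vertices next to an end of a path, and pieces
   are disjoint. *)
have chits : #|hits| <= 2 * l.
  have N0 : 0 < N by apply: leq_ltn_trans ltN.
  pose pt (u : 'I_l * bool) := if u.2 then head (x u.1) (q u.1)
    else head (last (x u.1) (q u.1)) (rev (belast (x u.1) (q u.1))).
  pose idx u := odflt (Ordinal N0) [pick i | pt u \in R i].
  apply: leq_trans (_ : #|idx @: setT| <= _); last first.
    by apply: leq_trans (leq_imset_card _ _) _; rewrite cardsT card_prod card_ord card_bool mulnC.
  apply/subset_leq_card/subsetP=> i; rewrite inE => /existsP[j /exists_inP[z zi zj]].
  have [j' nj'] := hit i j z zj zi.
  have [u ui] : exists u, pt u \in R i.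
    by case/orP: nj' => ?; [exists (j', true) | exists (j', false)].
  apply/imsetP; exists u => //; rewrite /idx; case: pickP => [i' i'u|/(_ i)]; last by rewrite ui.
  exact: Rd ui i'u.
have cfree : l.+1 <= #|~: hits|.
  have := cardsC hits; rewrite card_ord; move: ltN chits; clear.
  by set a := #|_|; set b := #|_|; clearbody a b; lia.
pose g (j : 'I_l.+1) := enum_val (widen_ord cfree j).
have g_inj : injective g by move=> j j' /enum_val_inj/(congr1 val) /= E; apply: val_inj.
have gfree j k z : z \in R (g j) -> z \in x k :: q k -> False.
  move=> zg zk; have := enum_valP (widen_ord cfree j); rewrite inE => /negP; apply.
  by rewrite inE; apply/existsP; exists k; apply/exists_inP; exists z.
pose alpha z := if [pick j | z \in x j :: q j] is Some j then ~~ odd (index z (x j :: q j)) else c z.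
have alphaP j z : z \in x j :: q j -> alpha z = ~~ odd (index z (x j :: q j)).
  by move=> zj; rewrite /alpha; case: pickP => [k zk|/(_ j)]; rewrite ?(dis _ _ _ zk zj) ?zj.
have alphaR j z : z \in R (g j) -> alpha z = c z.
  by move=> zj; rewrite /alpha; case: pickP => // k /(gfree _ _ _ zj).
(* Index [ord0] gets a piece alone; index [lift ord0 k] gets a piece and path [k]. *)
pose V j := R (g j) :|: (if unlift ord0 j is Some k then [set z | z \in x k :: q k] else set0).
pose E0 j := restrict (V j) (bichromatic alpha).
have E0sym j : symmetric (E0 j) by apply/restrict_sym/bichromatic_sym.
have [s0 s0S] : exists s, s \in S by apply/card_gt0P; apply: leq_ltn_trans ltS.
have Rn j : exists r, r \in R (g j) by have [r] := SR s0 (g j) s0S; exists r.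
have Vc j a b : a \in V j -> b \in V j -> connect (E0 j) a b.
  have conR a' b' : a' \in R (g j) -> b' \in R (g j) -> connect (E0 j) a' b'.
    move=> aR bR; apply: connect_sub (Rc _ _ _ aR bR) => u v /and3P[uR vR /andP[uv cuv]].
    apply: connect1; rewrite /E0 /restrict /bichromatic !inE uR vR uv /=.
    by rewrite (alphaR j) // (alphaR j).
  have [r rR] := Rn j.
  suff conr a' : a' \in V j -> connect (E0 j) r a'.
    move=> /conr aV /conr bV; apply: connect_trans bV.
    by rewrite (sym_connect_sym (E0sym j)).
  rewrite inE => /orP[|]; first exact: conR.
  case Ej: (unlift ord0 j) => [k|]; last by rewrite inE.
  have kV z : z \in x k :: q k -> z \in V j by move=> zk; rewrite /V inE Ej [z \in [set _ | _]]inE zk orbT.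
  have [[pk uk _ xS lS] _] := odd_pathP _ _ _ _ (xq k).
  rewrite inE => ak; have [r' r'R /andP[xr' cxr']] := SR (x k) (g j) xS.
  apply: connect_trans (conR _ _ rR r'R) _; apply: (@connect_trans _ _ (x k)).
    apply: connect1; rewrite /E0 /restrict /bichromatic (kV (x k)) ?mem_head // inE r'R e_sym xr' /=.
    rewrite (alphaR j) // (alphaP k) ?mem_head //= eqxx.
    by move: cxr'; rewrite Sc // eq_sym.
  apply: (path_connect _ ak); apply/(pathP (x k)) => n ltn.
  rewrite /E0 /restrict /bichromatic.
  have n1 : nth (x k) (x k :: q k) n \in x k :: q k by rewrite mem_nth //= ltnS ltnW.
  have n2 : nth (x k) (q k) n \in x k :: q k by rewrite inE mem_nth ?orbT.
  have a1 : alpha (nth (x k) (x k :: q k) n) = ~~ odd n.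
    by rewrite (alphaP k) // index_uniq //= ltnS ltnW.
  have a2 : alpha (nth (x k) (q k) n) = ~~ odd n.+1.
    rewrite (alphaP k) // -[nth _ (q k) n]/(nth (x k) (x k :: q k) n.+1).
    by rewrite index_uniq.
  by rewrite !kV // (pathP _ pk) // a1 a2 /=; case: (odd n).
have /fin_all_exists[E HE] j : exists E, tree_subgraph e (V j) E /\ subrel E (E0 j).
  have [||||E tE sE] := @spanning_tree _ e (E0 j) (V j); last by exists E.
  - by move=> a b /and3P[aV bV /andP[ab _]].
  - exact: E0sym.
  - by have [r rR] := Rn j; apply/set0Pn; exists r; rewrite inE rR.
  - exact: Vc.
exists V, E, alpha; split.
- move=> i j ij; rewrite -setI_eq0; apply/eqP/setP=> z; rewrite !inE.
  apply/negP=> /andP[/orP[zi|zi] /orP[zj|zj]].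
  + by move: ij; rewrite -(inj_eq g_inj) (Rd _ _ _ zi zj) eqxx.
  + by case: (unlift ord0 j) zj => [k|]; rewrite inE // => /(gfree _ _ _ zi).
  + by case: (unlift ord0 i) zi => [k|]; rewrite inE // => /(gfree _ _ _ zj).
  move: ij zi zj; case: unliftP => [k ->|->]; case: unliftP => [k' ->|->]; rewrite !inE //.
  by move=> kk' zk zk'; move: kk'; rewrite (dis _ _ _ zk zk') eqxx.
- by move=> i; case: (HE i).
- by move=> i a b /(proj2 (HE i))/and3P[_ _ /andP[_]].
(* The last vertex of path [k] has odd index, hence [alpha] is [false] there. Its core colour is
   [true], so its bichromatic neighbour in [R (g j)] is [false] too. *)
have mono k j : exists a b, [/\ a \in V (lift ord0 k), b \in V j, e a b & alpha a == alpha b].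
  have [[pk uk ok xS lS] _] := odd_pathP _ _ _ _ (xq k).
  have [r rR /andP[lr clr]] := SR _ (g j) lS.
  exists (last (x k) (q k)), r; split=> //.
  - by rewrite /V liftK !inE -in_cons mem_last orbT.
  - by rewrite inE rR.
  rewrite (alphaP k) ?mem_last // index_last // ok (alphaR j) //.
  by move: clr; rewrite Sc //; case: (c r).
move=> i j; case: (unliftP ord0 i) => [k ->|->] ij; first exact: mono.
case: (unliftP ord0 j) ij => [k ->|->]; last by rewrite eqxx.
have [a [b [aV bV ab alab]]] := mono k ord0.
by exists b, a; rewrite e_sym eq_sym.
Qed.

End Core.

(** * Finding a core *)

Definition degree_in (T : finType) (e : rel T) (D : {set T}) (x : T) : nat :=
  #|[set y in D | e x y]|.

Definition degree_sum (T : finType) (e : rel T) (D : {set T}) : nat :=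
  \sum_(x in D) degree_in e D x.

Section DegreeSum.

Variables (T : finType) (e : rel T).
Hypotheses (e_sym : symmetric e) (e_irr : irreflexive e).

Lemma degree_inD1 (D : {set T}) v x : v \in D ->
  degree_in e D x = e x v + degree_in e (D :\ v) x.
Proof.
move=> vD; rewrite /degree_in (cardsD1 v) inE vD /=; congr (_ + _).
by apply: eq_card => y; rewrite !inE andbA.
Qed.

Lemma degree_sumD1 (D : {set T}) v : v \in D ->
  degree_sum e D = degree_sum e (D :\ v) + 2 * degree_in e D v.
Proof.
move=> vD; rewrite /degree_sum (big_setD1 v) //=.
under eq_bigr => x _ do rewrite (degree_inD1 x vD).
rewrite big_split /= (_ : \sum_(i in D :\ v) e i v = degree_in e D v); first by lia.
rewrite (degree_inD1 v vD) e_irr add0n /degree_in -sum1dep_card [RHS]big_mkcondr /=.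
by apply: eq_bigr => x _; rewrite e_sym; case: (e v x).
Qed.

Lemma degree_sum_pairs (D : {set T}) :
  degree_sum e D = #|[set p : T * T | [&& p.1 \in D, p.2 \in D & e p.1 p.2]]|.
Proof.
rewrite -sum1dep_card /degree_sum.
under eq_bigr => x _ do rewrite /degree_in -sum1dep_card.
by rewrite pair_big_dep; apply: eq_bigl => -[x y].
Qed.

End DegreeSum.

(** Vertices are added one at a time, each with the colour that cuts at least half of its edges to
    the earlier ones. *)
Lemma max_cut (T : finType) (e : rel T) (D : {set T}) : symmetric e -> irreflexive e ->
  exists c, degree_sum e D <= 2 * degree_sum (bichromatic e c) D.
Proof.
move=> e_sym e_irr; have [n] := ubnP #|D|; elim: n D => // n IH D ltn.
have [->|[v vD]] := set_0Vmem D; first by exists xpredT; rewrite /degree_sum big_set0.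
have [|c0 Hc0] := IH (D :\ v); first by move: ltn; rewrite (cardsD1 v D) vD.
pose col b := fun x => if x == v then b else c0 x.
have same b : degree_sum (bichromatic e (col b)) (D :\ v) =
              degree_sum (bichromatic e c0) (D :\ v).
  apply: eq_bigr => x; rewrite !inE => /andP[xv _]; apply: eq_card => y; rewrite !inE.
  by rewrite /bichromatic /col (negPf xv); case: eqP.
have half : degree_in e D v <=
    degree_in (bichromatic e (col true)) D v + degree_in (bichromatic e (col false)) D v.
  rewrite /degree_in -cardsUI; apply: leq_trans (leq_addr _ _).
  apply/subset_leq_card/subsetP=> y; rewrite !inE /bichromatic /col eqxx => /andP[-> vy] /=.
  by rewrite vy; have [yv|_] := eqVneq y v; [rewrite yv e_irr in vy | case: (c0 y)].
have [b Hb] : exists b, degree_in e D v <= 2 * degree_in (bichromatic e (col b)) D v.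
  have [le|lt] := leqP (degree_in e D v) (2 * degree_in (bichromatic e (col true)) D v).
    by exists true.
  by exists false; move: half lt; clear; lia.
exists (col b).
have bs : symmetric (bichromatic e (col b)) by exact: bichromatic_sym.
have bi : irreflexive (bichromatic e (col b)) by move=> x; rewrite /bichromatic e_irr.
by rewrite !(@degree_sumD1 _ _ _ _ D v) // same; move: Hc0 Hb; clear; lia.
Qed.

Section DenseCore.

Variables (T : finType) (e : rel T).
Hypotheses (e_sym : symmetric e) (e_irr : irreflexive e).

Definition plain_core (S : {set T}) (N : nat) (R : 'I_N -> {set T}) : Prop :=
  [/\ forall i j x, x \in R i -> x \in R j -> i = j,
      forall i x, x \in R i -> x \notin S,
      forall i x y, x \in R i -> y \in R i -> connect (restrict (R i) e) x y &
      forall s i, s \in S -> exists2 r, r \in R i & e s r].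

Definition neighbours (A U : {set T}) : {set T} := [set y in A | [exists x in U, e x y]].

(* Choosing [D] minimal of average degree at least [2K] and then a maximal connected [U] whose
   contraction preserves the density makes the neighbourhood of [U] of minimum degree [K]. *)
Lemma dense_neighbourhood (K : nat) (D : {set T}) :
    0 < K -> D != set0 -> 2 * K * #|D| <= degree_sum e D ->
  exists U A : {set T}, [/\ U \subset D, A \subset D, [disjoint U & A], A != set0 &
    [/\ K * #|A| <= degree_sum e A,
        forall x y, x \in U -> y \in U -> connect (restrict U e) x y &
        forall y, y \in A -> exists2 x, x \in U & e y x]].
Proof.
move=> K0 D0 dD.
pose P (D' : {set T}) := [&& D' \subset D, D' != set0 & 2 * K * #|D'| <= degree_sum e D'].
have PD : P D by rewrite /P subxx D0.
case: (arg_minnP (fun A : {set T} => #|A|) PD) => {PD}D1 /and3P[sD1 nD1 dD1] minD1.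
(* The last clause says that contracting [U] to one vertex leaves average degree at least
   [2 * K]. *)
pose Q (U : {set T}) := [&& U \subset D1, [exists x, x \in U],
  [forall x in U, forall y in U, connect (restrict U e) x y] &
  2 * K * #|D1 :\: U|.+1 <= degree_sum e (D1 :\: U) + 2 * #|neighbours (D1 :\: U) U|].
have [x0 x0D] := set0Pn _ nD1.
have Q0 : Q [set x0].
  apply/and4P; split; first by rewrite sub1set.
  - by apply/existsP; exists x0; rewrite inE.
  - by apply/forall_inP=> x; rewrite inE => /eqP->; apply/forall_inP=> y; rewrite inE => /eqP->.
  rewrite (_ : #|D1 :\ x0|.+1 = #|D1|); last by rewrite (cardsD1 x0 D1) x0D.
  rewrite (leq_trans dD1) // (degree_sumD1 e_sym e_irr x0D) leq_add2l leq_mul2l /=.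
  apply/subset_leq_card/subsetP=> y; rewrite !inE => /andP[yD xy]; rewrite yD andbT.
  apply/andP; split; first by apply: contraTneq xy => ->; rewrite e_irr.
  by apply/exists_inP; exists x0; rewrite ?inE.
case: (arg_maxnP (fun A : {set T} => #|A|) Q0) => {Q0}U /and4P[sU /existsP[u0 u0U] cU dU] maxU.
have conU x y : x \in U -> y \in U -> connect (restrict U e) x y.
  by move=> xU yU; move/forall_inP/(_ x xU)/forall_inP/(_ y yU): cU.
set B := D1 :\: U in dU; set A := neighbours B U in dU.
have AB : A \subset B by apply/subsetP=> y; rewrite inE => /andP[].
have BD1 : B \subset D1 by apply: subsetDl.
have nbA y : y \in A -> exists2 x, x \in U & e y x.
  by rewrite inE => /andP[_ /exists_inP[x xU xy]]; exists x => //; rewrite e_sym.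
have degA v : v \in A -> K <= degree_in e A v.
  move=> vA; have vB := subsetP AB v vA; have [u uU vu] := nbA v vA.
  have vU : v \notin U by move: vB; rewrite inE => /andP[].
  have BvE : D1 :\: (v |: U) = B :\ v by rewrite setDDl setUC.
  have cB : #|B| = #|B :\ v|.+1 by rewrite (cardsD1 v) vB.
  have : ~~ Q (v |: U).
    by apply/negP=> /maxU; rewrite /geq /= cardsU1 vU add1n ltnn.
  have sub' : {subset U <= v |: U} by move=> x xU; rewrite inE xU orbT.
  have con' x : x \in U -> connect (restrict (v |: U) e) v x.
    move=> xU; apply: (@connect_trans _ _ u).
      by apply: connect1; rewrite /restrict !inE eqxx uU orbT.
    apply: connect_sub (conU u x uU xU) => a b /and3P[aU bU ab].
    by apply: connect1; rewrite /restrict !sub'.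
  have -> : Q (v |: U) = (2 * K * #|B| <= degree_sum e (B :\ v) +
       2 * #|neighbours (B :\ v) (v |: U)|).
    rewrite /Q BvE -cB; have -> : v |: U \subset D1.
      by rewrite subUset sU sub1set (subsetP BD1).
    have -> : [exists x, x \in v |: U] by apply/existsP; exists v; rewrite setU11.
    suff -> : [forall x in v |: U, forall y in v |: U, connect (restrict (v |: U) e) x y] by [].
    have csym := sym_connect_sym (restrict_sym (v |: U) e_sym).
    have conv x : x \in v |: U -> connect (restrict (v |: U) e) v x.
      by rewrite in_setU1 => /orP[/eqP->|/con'].
    apply/forall_inP=> x xU; apply/forall_inP=> y yU.
    by apply: connect_trans (conv y yU); rewrite csym conv.
  rewrite -ltnNge; have dB := degree_sumD1 e_sym e_irr vB.
  (* Contracting [v] into [U] loses one edge, plus one for each neighbour of [v] in [A]. As [U] is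
     maximal, more than [K] edges must be lost. *)
  have : #|A| + degree_in e B v <= (#|neighbours (B :\ v) (v |: U)| + degree_in e A v).+1.
    pose Nv := [set y in B | e v y].
    have -> : degree_in e B v = #|Nv| by [].
    have -> : degree_in e A v = #|A :&: Nv|.
      apply: eq_card => y; rewrite in_setI in_set; case yA: (y \in A) => //=.
      by rewrite in_set (subsetP AB).
    rewrite -cardsUI -addSn leq_add2r.
    apply: leq_trans (_ : #|v |: neighbours (B :\ v) (v |: U)| <= _); last first.
      by rewrite cardsU1 -[X in _ <= X]add1n leq_add2r leq_b1.
    apply/subset_leq_card/subsetP=> y; rewrite [_ \in v |: _]in_setU1; case: (eqVneq y v) => //= yv.
    rewrite !inE yv => /orP[/andP[-> /exists_inP[x xU xy]]|/andP[-> vy]] /=.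
      by apply/exists_inP; exists x; rewrite ?sub'.
    by apply/exists_inP; exists v; rewrite ?setU11.
  move: dU dB cB; clear.
  set a := #|A|; set b := #|B|; set b' := #|B :\ v|; set d := degree_sum _ _.
  set d' := degree_sum _ _; set f := degree_in e B v; set n := #|neighbours _ _|.
  set h := degree_in _ _ _; clearbody a b b' d d' f n h; clear.
  move=> dU dE; move: dU; rewrite dE mulnS; set m := 2 * K * b; clearbody m; lia.
exists U, A; split.
- exact: subset_trans sU sD1.
- exact: subset_trans AB (subset_trans BD1 sD1).
- rewrite -setI_eq0; apply/eqP/setP=> y; rewrite in_setI in_set0.
  by apply/negP=> /andP[yU /(subsetP AB)]; rewrite inE yU.
(* Without neighbours of [U], the rest [B] would itself be dense, against the minimality of [D1]. *)
- apply/negP=> /eqP A0; move: dU; rewrite A0 cards0 muln0 addn0 => dU.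
  have [B0|B0] := eqVneq B set0.
    by move: dU; rewrite B0 /degree_sum big_set0 leqn0 !muln_eq0; case: (K) K0.
  have : P B.
    rewrite /P B0 (subset_trans BD1 sD1) /=; apply: leq_trans dU.
    by rewrite leq_mul2l leqnSn orbT.
  move/minD1; rewrite leqNgt => /negP; apply.
  apply: proper_card; apply/properP; split=> //; exists u0; first exact: (subsetP sU).
  by rewrite inE u0U.
split=> //; rewrite mulnC -sum_nat_const; apply: leq_sum => v; exact: degA.
Qed.

(** Each application of [dense_neighbourhood] halves the density: [U] becomes a piece, and the
    search continues inside [A], all of whose vertices have a neighbour in [U]. *)
Lemma dense_core (s N : nat) (D : {set T}) :
    0 < s -> D != set0 -> 2 ^ N * s * #|D| <= degree_sum e D ->
  exists S (R : 'I_N -> {set T}), [/\ plain_core S R, S \subset D,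
    forall i, R i \subset D & s <= #|S|].
Proof.
move=> s0; elim: N D => [|N IH] D D0 dD.
  exists D, (fun _ => set0); split=> //; first by split=> [[]|[]|[]|? []].
    by move=> i; apply: sub0set.
  have cD : 0 < #|D| by rewrite card_gt0.
  rewrite -(leq_pmul2r cD); move: dD; rewrite expn0 mul1n => /leq_trans; apply.
  rewrite -sum_nat_const; apply: leq_sum => x _.
  by apply: subset_leq_card; apply/subsetP=> y; rewrite inE => /andP[].
rewrite expnS -(mulnA 2) in dD.
have [|U [A [sU sA dUA A0 [dA cU nA]]]] := dense_neighbourhood _ D0 dD.
  by rewrite muln_gt0 expn_gt0 s0.
have [S [R [[Rd RS Rc SR] SA RA leS]]] := IH A A0 dA.
pose R' (i : 'I_N.+1) := if unlift ord0 i is Some j then R j else U.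
have UA x : x \in U -> x \in A -> False by move=> xU xA; rewrite (disjointFr dUA) in xA.
have RU i x : x \in R i -> x \in U -> False by move/(subsetP (RA i)) => xA /UA; apply.
exists S, R'; split=> //; last first.
- by move=> i; rewrite /R'; case: (unlift _ _) => [j|//]; apply: subset_trans (RA j) sA.
- exact: subset_trans SA sA.
split.
- move=> i j x; rewrite /R'; case: unliftP => [i' ->|->]; case: unliftP => [j' ->|->] //.
  + by move=> xi xj; rewrite (Rd _ _ _ xi xj).
  + by move=> xi /(RU _ _ xi).
  + by move=> xU /RU /(_ xU).
- move=> i x; rewrite /R'; case: (unlift _ _) => [j /RS //|xU].
  by apply/negP=> /(subsetP SA)/(UA _ xU).
- by move=> i x y; rewrite /R'; case: (unlift _ _) => [j|]; [apply: Rc | apply: cU].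
move=> t i tS; rewrite /R'; case: (unlift _ _) => [j|]; first exact: SR.
by apply: nA; apply: (subsetP SA).
Qed.

End DenseCore.

Definition has_core (T : finType) (e : rel T) (s N : nat) : Prop :=
  exists c S (R : 'I_N -> {set T}), core e c S R /\ s <= #|S|.

(** One factor 2 pays for passing to a maximum cut, the factor in [2 * s] for keeping the larger
    colour class of [S]. *)
Lemma dense_has_core (T : finType) (e : rel T) (s N : nat) (D : {set T}) :
    symmetric e -> irreflexive e -> 0 < s -> D != set0 ->
    2 * (2 ^ N * (2 * s)) * #|D| <= degree_sum e D -> has_core e s N.
Proof.
move=> e_sym e_irr s0 D0 dD; have [c dc] := max_cut D e_sym e_irr.
have bs : symmetric (bichromatic e c) by exact: bichromatic_sym.
have bi : irreflexive (bichromatic e c) by move=> x; rewrite /bichromatic e_irr.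
have [|||S [R [[Rd RS Rc SR] _ _ leS]]] := @dense_core _ _ bs bi (2 * s) N D => //.
  by rewrite muln_gt0.
  by rewrite -(leq_pmul2l (isT : 0 < 2)) mulnA (leq_trans dD).
pose col b := fun x => c x == b; pose Sb b := [set x in S | c x == b].
have [b leb] : exists b, s <= #|Sb b|.
  have cS : #|S| = #|Sb true| + #|Sb false|.
    rewrite -(cardsID (Sb true) S); congr (_ + _); apply: eq_card => x; rewrite !inE.
      by rewrite andbA andbb.
    by case: (x \in S) => //=; case: (c x).
  have [le|lt] := leqP s #|Sb true|; first by exists true.
  exists false; move: leS lt; rewrite cS; clear.
  by set x := #|_|; set y := #|_|; clearbody x y; lia.
have colE x y : bichromatic e (col b) x y = bichromatic e c x y.
  by rewrite /bichromatic /col; case: b {leb}; case: (c x); case: (c y).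
exists (col b), (Sb b), R; split=> //; split=> //.
- by move=> i x /RS; apply: contra; rewrite inE => /andP[].
- by move=> x; rewrite inE => /andP[].
- move=> i x y xi yi; rewrite (@eq_connect _ _ (restrict (R i) (bichromatic e c))) ?Rc //.
  by move=> u v; rewrite /restrict colE.
by move=> t i; rewrite inE => /andP[tS _]; have [r ri tr] := SR t i tS; exists r; rewrite ?colE.
Qed.

(** * Cores in unbalanced bipartite graphs *)

Definition clique (T : finType) (h : rel T) (Q : {set T}) : bool :=
  [forall x in Q, forall y in Q, (x != y) ==> h x y].

Lemma cliqueP (T : finType) (h : rel T) (Q : {set T}) :
  reflect (forall x y, x \in Q -> y \in Q -> x != y -> h x y) (clique h Q).
Proof.
apply: (iffP forall_inP) => [H x y xQ yQ xy|H x xQ].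
  by move/forall_inP/(_ y yQ)/implyP: (H x xQ); apply.
by apply/forall_inP=> y yQ; apply/implyP; apply: H.
Qed.

(** Some vertex [v] has degree at most [C]. Cliques containing [v] are determined by subsets of its
    neighbourhood, at most [2 ^ C] many; the others lie in [D :\ v]. *)
Lemma card_cliques (T : finType) (h : rel T) (C : nat) (D : {set T}) :
    (forall A : {set T}, A \subset D -> degree_sum h A <= C * #|A|) ->
  #|[set Q : {set T} | [&& Q \subset D, Q != set0 & clique h Q]]| <= 2 ^ C * #|D|.
Proof.
have [n] := ubnP #|D|; elim: n D => // n IH D ltn sparse.
set K := fun A : {set T} => [set Q : {set T} | [&& Q \subset A, Q != set0 & clique h Q]].
have [D0|[v0 v0D]] := set_0Vmem D.
  rewrite D0 cards0 muln0 leqn0 cards_eq0; apply/eqP/setP=> Q.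
  by rewrite !inE subset0 andbA andbN.
have [v vD vC] : exists2 v, v \in D & degree_in h D v <= C.
  apply/exists_inP; apply: contraT; rewrite negb_exists_in => /forall_inP H.
  have := sparse D (subxx D); rewrite leqNgt => /negP; case.
  have le : C.+1 * #|D| <= degree_sum h D.
    by rewrite mulnC -sum_nat_const; apply: leq_sum => x xD; rewrite ltnNge H.
  by apply: leq_trans le; rewrite mulSn -[X in X < _]add0n ltn_add2r; apply/card_gt0P; exists v0.
rewrite -/(K D) -(cardsID [set Q : {set T} | v \in Q] (K D)).
have -> : 2 ^ C * #|D| = 2 ^ C + 2 ^ C * #|D :\ v| by rewrite (cardsD1 v D) vD mulnDr muln1.
apply: leq_add.
  pose Nv := [set y in D | h v y].
  rewrite -(@card_in_imset _ _ (fun Q : {set T} => Q :\ v)); last first.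
    move=> Q Q'; rewrite !inE => /andP[_ vQ] /andP[_ vQ'] E.
    by rewrite -(setD1K vQ) -(setD1K vQ') E.
  apply: leq_trans (_ : #|powerset Nv| <= _); last by rewrite card_powerset leq_exp2l.
  apply/subset_leq_card/subsetP=> _ /imsetP[Q + ->].
  rewrite !inE => /andP[/and3P[/subsetP QD _ /cliqueP Qc] vQ].
  apply/subsetP=> y; rewrite !inE => /andP[yv yQ]; rewrite QD //=.
  by apply: Qc; rewrite // eq_sym.
apply: leq_trans (IH (D :\ v) _ _); last first.
- by move=> A AD; apply: sparse; apply: subset_trans AD (subsetDl _ _).
- by move: ltn; rewrite (cardsD1 v D) vD.
apply/subset_leq_card/subsetP=> Q; rewrite !inE => /andP[vQ /and3P[QD -> ->]].
by rewrite subsetD1 QD vQ.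
Qed.

Section BipartiteCore.

Variables (T : finType) (e : rel T) (A B : {set T}) (s N : nat).
Hypotheses (e_sym : symmetric e) (AB : [disjoint A & B]) (s_gt0 : 0 < s).

Let nb (b : T) : {set T} := [set a in A | e b a].

Lemma has_core_of_common_neighbours (B' Q : {set T}) :
    B' \subset B -> Q \subset A -> N <= #|B'| -> s <= #|Q| ->
    (forall b x, b \in B' -> x \in Q -> e b x) -> has_core e s N.
Proof.
move=> B'B QA leN leQ BQ.
have AF x : x \in B -> x \in A = false by move=> xB; rewrite (disjointFl AB).
pose R (i : 'I_N) := [set enum_val (widen_ord leN i)].
have RB' i x : x \in R i -> x \in B' by rewrite inE => /eqP->; apply: enum_valP.
have RB i x : x \in R i -> x \in B by move/RB'/(subsetP B'B).
exists (fun x => x \in A), Q, R; split=> //; split.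
- move=> i j x; rewrite !inE => /eqP-> /eqP/enum_val_inj/(congr1 val) /= E.
  exact: val_inj.
- by move=> i x /RB xB; apply/negP=> /(subsetP QA); rewrite AF.
- by move=> x /(subsetP QA).
- by move=> i x y; rewrite !inE => /eqP-> /eqP->.
move=> t i tQ; exists (enum_val (widen_ord leN i)); first by rewrite inE.
have rR : enum_val (widen_ord leN i) \in R i by rewrite inE.
by rewrite /bichromatic e_sym BQ ?(RB' i) // (subsetP QA t tQ) (AF _ (RB _ _ rR)).
Qed.

(* A partial assignment [f] of pairs of common neighbours to vertices of [B], injective on
   unordered pairs, turns the paths a - b - a' into the edges of a graph on [A]. *)
Definition pairing (f : {ffun T -> option (T * T)}) : Prop :=
  (forall b x y, f b = Some (x, y) -> [/\ b \in B, x \in nb b, y \in nb b & x != y]) /\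
  (forall b b' x y, f b = Some (x, y) -> f b' = Some (x, y) \/ f b' = Some (y, x) -> b = b').

Definition paired (f : {ffun T -> option (T * T)}) : rel T :=
  fun x y => [exists b, (f b == Some (x, y)) || (f b == Some (y, x))].

Lemma pairedP (f : {ffun T -> option (T * T)}) x y :
  reflect (exists b, f b = Some (x, y) \/ f b = Some (y, x)) (paired f x y).
Proof.
apply: (iffP existsP) => -[b H]; exists b; first by case/orP: H => /eqP; [left | right].
by case: H => ->; rewrite eqxx ?orbT.
Qed.

Lemma paired_sym (f : {ffun T -> option (T * T)}) : symmetric (paired f).
Proof. by move=> x y; apply: eq_existsb => b; rewrite orbC. Qed.

Lemma pairedE (f : {ffun T -> option (T * T)}) x y : pairing f -> paired f x y ->
  exists b, [/\ b \in B, x \in nb b, y \in nb b, x != y & f b = Some (x, y) \/ f b = Some (y, x)].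
Proof.
case=> f1 _ /pairedP[b H]; exists b; case: (H) => /f1[bB xb yb xy]; split=> //.
by rewrite eq_sym.
Qed.

Lemma paired_irr (f : {ffun T -> option (T * T)}) : pairing f -> irreflexive (paired f).
Proof.
by move=> fp x; apply/negbTE/negP=> /(pairedE fp)[b [_ _ _]]; rewrite eqxx.
Qed.

(** A plain core of the paired graph is subdivided: a piece receives each vertex of [B] assigned to
    a pair inside it or between it and [S]. A vertex of [B] carries one pair, so the pieces stay
    disjoint, and membership in [A] is the colouring. *)
Lemma has_core_of_pairing (f : {ffun T -> option (T * T)}) (D : {set T}) :
    pairing f -> D \subset A -> D != set0 -> 2 ^ N * s * #|D| <= degree_sum (paired f) D ->
  has_core e s N.
Proof.
move=> fp DA D0 dD.
have [S [R [[Rd RS Rc SR] SD RD leS]]] := dense_core (paired_sym f) (paired_irr fp) s_gt0 D0 dD.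
have RA i x : x \in R i -> x \in A by move=> xi; rewrite (subsetP DA) // (subsetP (RD i)).
have SA x : x \in S -> x \in A by move=> xi; rewrite (subsetP DA) // (subsetP SD).
have AF x : x \in B -> x \in A = false by move=> xB; rewrite (disjointFl AB).
pose link i b := [exists x in R i, [exists y in R i :|: S,
   (f b == Some (x, y)) || (f b == Some (y, x))]].
have linkP i b : link i b -> exists x y, [/\ x \in R i, y \in R i :|: S, b \in B, e b x & e b y] /\
    (f b = Some (x, y) \/ f b = Some (y, x)).
  case/exists_inP=> x xi /exists_inP[y yi H]; exists x, y.
  have H' : f b = Some (x, y) \/ f b = Some (y, x) by case/orP: H => /eqP; [left|right].
  have [bB xb yb] : [/\ b \in B, x \in nb b & y \in nb b].
    by case: (H') => /(proj1 fp)[].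
  by split=> //; split=> //; [move: xb | move: yb]; rewrite inE => /andP[].
pose R' i := R i :|: [set b | link i b].
have link1 i b : link i b -> b \in B by case/linkP=> x [y [[]]].
exists (fun x => x \in A), S, R'; split=> //; split.
- move=> i j z; rewrite !inE => /orP[zi|zi] /orP[zj|zj]; first exact: Rd zi zj.
  + by have := RA _ _ zi; rewrite (AF _ (link1 _ _ zj)).
  + by have := RA _ _ zj; rewrite (AF _ (link1 _ _ zi)).
  have [x [y [[xi yi _ _ _] fz]]] := linkP _ _ zi.
  have [x' [y' [[xj yj _ _ _] fz']]] := linkP _ _ zj.
  rewrite !inE in yi yj.
  have RSN k w : w \in R k -> w \in S -> False by move/RS/negP.
  have [E|E] : x = x' \/ (x = y' /\ y = x').
    by case: fz fz' => -> [] [-> ->]; [left|right|right|left].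
  + by rewrite -E in xj; apply: Rd xi xj.
  case: E => Ex Ey; rewrite -Ey in xj; case/orP: yi => [yi|yS]; first exact: Rd yi xj.
  by case: (RSN _ _ xj yS).
- move=> i z; rewrite inE => /orP[/RS //|]; rewrite inE => zi.
  by apply/negP=> /SA; rewrite AF // (link1 _ _ zi).
- exact: SA.
- move=> i.
  have bs : symmetric (restrict (R' i) (bichromatic e (fun x => x \in A))).
    by apply/restrict_sym/bichromatic_sym.
  have step b x : link i b -> x \in R i -> e b x ->
      connect (restrict (R' i) (bichromatic e (fun x => x \in A))) x b.
    move=> lb xi bx; apply: connect1; rewrite /restrict /bichromatic !inE xi lb orbT e_sym bx /=.
    by rewrite (RA _ _ xi) AF // (link1 _ _ lb).
  have inR x y : x \in R i -> y \in R i ->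
      connect (restrict (R' i) (bichromatic e (fun x => x \in A))) x y.
    move=> xi yi; apply: connect_sub (Rc i x y xi yi) => {xi yi}x {}y /and3P[xi yi xy].
    have [b [bB xb yb _ fb]] := pairedE fp xy; rewrite !inE in xb yb.
    have lb : link i b.
      apply/exists_inP; exists x => //; apply/exists_inP; exists y; first by rewrite inE yi.
      by case: fb => ->; rewrite eqxx ?orbT.
    apply: (@connect_trans _ _ b); first by apply: step => //; case/andP: xb.
    by rewrite (sym_connect_sym bs); apply: step => //; case/andP: yb.
  have toR z : z \in R' i -> exists2 x, x \in R i &
      connect (restrict (R' i) (bichromatic e (fun x => x \in A))) x z.
    rewrite inE => /orP[zi|]; first by exists z.
    by rewrite inE => lz; have [x [y [[xi _ _ zx _] _]]] := linkP _ _ lz; exists x; rewrite ?step.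
  move=> z z' /toR[x xi xz] /toR[x' xi' xz']; rewrite (sym_connect_sym bs) in xz.
  by apply: connect_trans xz (connect_trans (inR x x' xi xi') xz').
move=> t i tS; have [r ri tr] := SR t i tS; have [b [bB tb rb _ fb]] := pairedE fp tr.
exists b.
  rewrite !inE; apply/orP; right; apply/exists_inP; exists r => //.
  apply/exists_inP; exists t; first by rewrite inE tS orbT.
  by case: fb => ->; rewrite eqxx ?orbT.
rewrite inE in tb; case/andP: tb => tA bt.
by rewrite /bichromatic e_sym bt tA AF.
Qed.

(** Take a pairing with as many assigned vertices as possible. If its graph is nowhere dense enough
    for a core, at most [K * #|A|] vertices are assigned. The neighbourhood of any other vertex of
    [B] is a clique, by maximality, so few sets occur as neighbourhoods and by pigeonhole more than
    [N] vertices share one. *)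
Lemma bipartite_has_core :
    (forall b, b \in B -> s <= #|nb b|) ->
    (2 ^ N * s + N * 2 ^ (2 ^ N * s)) * #|A| < #|B| ->
  has_core e s N.
Proof.
move=> nbs; set K := 2 ^ N * s => ltB.
pose good (f : {ffun T -> option (T * T)}) := [forall b, forall x, forall y,
  (f b == Some (x, y)) ==> [&& b \in B, x \in nb b, y \in nb b & x != y] &&
    [forall b', (f b' == Some (x, y)) || (f b' == Some (y, x)) ==> (b == b')]].
have goodP f : reflect (pairing f) (good f).
  apply: (iffP forallP) => [H|[f1 f2] b].
    have H' b x y : f b = Some (x, y) -> [&& b \in B, x \in nb b, y \in nb b & x != y] &&
        [forall b', (f b' == Some (x, y)) || (f b' == Some (y, x)) ==> (b == b')].
      by move=> fb; move/forallP/(_ x)/forallP/(_ y): (H b); rewrite fb eqxx.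
    split=> [b x y /H' /andP[/and4P[]] //|b b' x y /H' /andP[_ /forallP/(_ b')] + fb'].
    by move/implyP=> /(_ _)/eqP; apply; case: fb' => ->; rewrite eqxx ?orbT.
  apply/forallP=> x; apply/forallP=> y; apply/implyP=> /eqP fb.
  have [-> -> -> ->] := f1 _ _ _ fb; apply/forallP=> b'; apply/implyP=> fb'.
  apply/eqP; apply: f2 fb _; by case/orP: fb' => /eqP; [left|right].
have good0 : good [ffun=> None] by apply/goodP; split=> b; rewrite ffunE.
pose J (f : {ffun T -> option (T * T)}) := [set b | f b != None].
case: (arg_maxnP (fun f => #|J f|) good0) => f /goodP fp fmax.
have [/existsP[D /and3P[DA D0 dD]]|/existsPn sparse] :=
  boolP [exists D : {set T}, [&& D \subset A, D != set0 & K * #|D| <= degree_sum (paired f) D]].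
  exact: has_core_of_pairing fp DA D0 dD.
have {}sparse (D : {set T}) : D \subset A -> degree_sum (paired f) D <= K * #|D|.
  move=> DA; have [->|D0] := eqVneq D set0; first by rewrite /degree_sum big_set0.
  by move: (sparse D); rewrite DA D0 /= -ltnNge => /ltnW.
have JB : J f \subset B.
  apply/subsetP=> b; rewrite inE; case fb: (f b) => [[x y]|//] _.
  by case: (proj1 fp _ _ _ fb).
have cJ : #|J f| <= K * #|A|.
  apply: leq_trans (sparse A (subxx A)); rewrite degree_sum_pairs.
  rewrite -[X in _ <= X](card_imset _ (@Some_inj _)) -(@card_in_imset _ _ f (J f)).
    apply/subset_leq_card/subsetP=> p /imsetP[b + ->]; rewrite inE.
    case fb: (f b) => [[x y]|//] _; rewrite imset_f // inE /=.
    have [_ + + _] := proj1 fp _ _ _ fb; rewrite !inE => /andP[-> _] /andP[-> _] /=.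
    by apply/pairedP; exists b; left.
  move=> b b'; rewrite !inE; case fb: (f b) => [[x y]|//] _ _ fb'.
  by apply: (proj2 fp) fb _; left.
pose B0 := B :\: J f.
have cliqueB b : b \in B0 -> clique (paired f) (nb b).
  rewrite !inE negbK => /andP[/eqP fb bB]; apply/cliqueP=> x y xb yb xy.
  apply/contraT=> /pairedP nxy; pose f' := [ffun z => if z == b then Some (x, y) else f z].
  have : good f'.
    apply/goodP; split=> [b1 x1 y1|b1 b2 x1 y1]; rewrite !ffunE.
      by case: eqP => [->|_]; [case=> <- <- | apply: (proj1 fp)].
    case: eqP => [->|_]; case: eqP => [->|_] //; last exact: (proj2 fp).
      by case=> <- <- nf; case: nxy; exists b2.
    move=> fb1 [] [Ex Ey]; case: nxy; exists b1; rewrite fb1 Ex Ey; by [left|right].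
  move/fmax; rewrite /geq /= leqNgt => /negP; case; apply: proper_card.
  apply/properP; split.
    by apply/subsetP=> z; rewrite !inE ffunE; case: (z == b).
  by exists b; rewrite !inE ?ffunE ?eqxx // fb.
have cnb : #|nb @: B0| <= 2 ^ K * #|A|.
  apply: leq_trans (card_cliques sparse); apply/subset_leq_card/subsetP=> _ /imsetP[b bB ->].
  rewrite inE cliqueB // andbT -card_gt0; apply/andP; split.
    by apply/subsetP=> x; rewrite inE => /andP[].
  by apply: leq_trans s_gt0 (nbs b _); move: bB; rewrite inE => /andP[].
have ltB0 : N * #|nb @: B0| < #|B0|.
  have cB : #|B| = #|J f| + #|B0| by rewrite -(cardsID (J f) B) (setIidPr JB).
  have le : N * #|nb @: B0| <= N * (2 ^ K * #|A|) by rewrite leq_mul2l cnb orbT.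
  move: ltB cJ le; rewrite cB mulnDl mulnA; clear.
  set x1 := K * _; set x2 := _ * #|A|; set x3 := N * _; set x4 := #|J f|; set x5 := #|B0|.
  clearbody x1 x2 x3 x4 x5; lia.
have [Q ltQ] : exists Q, N < #|[set b in B0 | nb b == Q]|.
  apply/existsP; apply: contraLR ltB0; rewrite negb_exists -leqNgt => /forallP H.
  by apply: card_le_fibers => y; rewrite leqNgt H.
have [b0] : exists b, b \in [set b in B0 | nb b == Q].
  by apply/card_gt0P; apply: leq_ltn_trans ltQ.
rewrite inE => /andP[b0B /eqP b0Q].
apply: (@has_core_of_common_neighbours [set b in B0 | nb b == Q] Q).
- by apply/subsetP=> b; rewrite !inE => /andP[/andP[]].
- by rewrite -b0Q; apply/subsetP=> x; rewrite inE => /andP[].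
- exact: ltnW.
- by rewrite -b0Q nbs //; move: b0B; rewrite inE => /andP[].
by move=> b x; rewrite inE => /andP[_ /eqP <-]; rewrite inE => /andP[].
Qed.

End BipartiteCore.

(** * Extending precolourings *)

Definition extends (T : finType) (e : rel T) (q d : nat) (Z : {set T}) (f0 f : T -> 'I_q) : Prop :=
  [/\ forall x, x \in Z -> f x = f0 x,
      forall x y, x \in Z -> y \notin Z -> e x y -> f x != f y &
      forall x, x \notin Z -> #|[set y | e x y & f y == f x]| <= d].

Section Decomposed.

Variables (T : finType) (e : rel T) (k d : nat).
Hypotheses (e_sym : symmetric e) (e_irr : irreflexive e).
Variables (D Z X U : {set T}) (c : T -> bool) (F : finType) (lab : T -> F) (a : F -> {set T}).
Variable f0 : T -> 'I_(6 * k + 3).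
Hypotheses (eD : forall x y, e x y -> x \in D) (ZD : Z \subset D) (leZ : #|Z| <= 4 * k + 1).
Hypotheses (leX : #|X| <= 2 * k) (XU : [disjoint X & U]).
Hypothesis Uc : forall u v, u \in U -> v \in U -> e u v -> c u != c v.
Hypothesis labE : label_closed e (~: (X :|: U)) lab.
Hypothesis attach : forall w v, w \notin X :|: U -> v \in U -> e w v -> v \in a (lab w).
Hypothesis aU : forall y, a y \subset U /\ #|a y| <= 1.
Hypothesis geU : 4 * k + 3 <= #|U :&: D|.
Hypothesis IH : forall (D' Z' : {set T}) (f0' : T -> 'I_(6 * k + 3)),
  D' \proper D -> Z' \subset D' -> #|Z'| <= 4 * k + 1 ->
  exists f, extends (restrict D' e) d Z' f0' f.

(** The piece with label [y]; the at most [2k + 1] vertices of [P y] separate it from the rest. *)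
Let W (y : F) : {set T} := [set w | (w \notin X :|: U) && (lab w == y)].
Let P (y : F) : {set T} := X :|: a y.

Let cP y : #|P y| <= 2 * k + 1.
Proof. by apply: leq_trans (leq_card_setU _ _) (leq_add leX (proj2 (aU y))). Qed.

Let PXU y x : x \in P y -> x \in X :|: U.
Proof. by rewrite !inE => /orP[->//|/(subsetP (proj1 (aU y)))->]; rewrite orbT. Qed.

Let WP y x : x \in W y -> x \in P y -> False.
Proof. by rewrite inE => /andP[/negP xN _] /PXU. Qed.

Let eD2 x y : e x y -> y \in D.
Proof. by rewrite e_sym; apply: eD. Qed.

Let W_nbr y w v : w \in W y -> e w v -> v \in W y :|: P y.
Proof.
rewrite inE => /andP[wN /eqP wy] wv; rewrite inE.
have [vXU|vN] := boolP (v \in X :|: U); last first.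
  rewrite inE vN -wy /= (labE _ _ wv) ?eqxx // in_setC //.
move: vXU; rewrite in_setU => /orP[vX|vU]; first by rewrite [v \in P y]inE vX orbT.
by rewrite [v \in P y]inE -wy (attach wN vU wv) !orbT.
Qed.

(* Extend to the piece, [P y] and all of [Z] first, then to the rest with [P y] precoloured. *)
Lemma extend_large_piece y : 2 * k < #|Z :&: W y| -> exists f, extends e d Z f0 f.
Proof.
move=> large.
have cZW : #|Z :\: W y| <= 2 * k.
  by have := cardsID (W y) Z; move: leZ large; clear; set u := #|_|; set v := #|_|;
     set w := #|_|; clearbody u v w; lia.
pose D1 := D :&: (W y :|: P y :|: Z); pose D2 := D :\: W y.
(* At most [2k + (2k + 1)] vertices, which is exactly the size allowed. *)
pose Z2 := (Z :\: W y) :|: (P y :&: D).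
have [|||f1 [f1Z f1e f1d]] := IH (D' := D1) (Z' := Z) f0; rewrite ?leZ //.
- rewrite properE subsetIl /=; apply/negP=> /subsetP DD1.
  suff : #|U :&: D| <= #|a y| + #|Z :\: W y|.
    by move: geU (proj2 (aU y)) cZW; clear; set u := #|_|; set v := #|_|;
       set w := #|_|; clearbody u v w; lia.
  apply: leq_trans (leq_card_setU _ _); apply/subset_leq_card/subsetP=> u.
  rewrite inE => /andP[uU uD]; move: (DD1 u uD).
  have uX : u \notin X by rewrite (disjointFl XU).
  have uW : u \notin W y by rewrite !inE uU orbT.
  by rewrite /D1 /P !in_setU in_setI in_setD !in_setU uD (negPf uW) (negPf uX).
- by rewrite subsetI ZD subsetUr.
have [|||f2 [f2Z f2e f2d]] := IH (D' := D2) (Z' := Z2) f1.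
- rewrite properE subsetDl; have /card_gt0P[z] : 0 < #|Z :&: W y| by apply: leq_trans large.
  rewrite in_setI => /andP[zZ zW]; apply/subsetPn; exists z; first exact: (subsetP ZD).
  by rewrite in_setD zW.
- apply/subsetP=> x; rewrite in_setU in_setI !in_setD => /orP[/andP[-> /(subsetP ZD)->]//|].
  by case/andP=> xP ->; rewrite andbT; apply/negP=> /WP; apply.
- have cPD : #|P y :&: D| <= 2 * k + 1.
    exact: leq_trans (subset_leq_card (subsetIl _ _)) (cP y).
  apply: leq_trans (leq_card_setU _ _) _; apply: leq_trans (leq_add cZW cPD) _.
  by clear; lia.
pose f x := if x \in W y then f1 x else f2 x.
have ff1 x : x \in D1 -> f x = f1 x.
  rewrite /D1 /f inE => /andP[xD xW]; case: ifPn => // xNW; apply: f2Z.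
  move: xW; rewrite in_setU => /orP[|xZ]; last by rewrite /Z2 in_setU in_setD xNW xZ.
  by rewrite in_setU (negPf xNW) => /= xP; rewrite /Z2 in_setU in_setI xP xD orbT.
have fZ1 x : x \in Z -> f x = f1 x.
  by move=> xZ; apply: ff1; rewrite /D1 in_setI in_setU xZ orbT (subsetP ZD).
have ff2 x : x \notin W y -> f x = f2 x by move=> xW; rewrite /f (negPf xW).
exists f; split=> [x xZ|x x' xZ x'Z xx'|x xZ].
- by rewrite fZ1 // f1Z.
- have xD := eD xx'; have x'D := eD2 xx'.
  have [x'W|x'W] := boolP (x' \in W y :|: P y).
    have xD1 : x \in D1 by rewrite /D1 inE xD in_setU xZ orbT.
    have x'D1 : x' \in D1 by rewrite /D1 inE x'D in_setU x'W.
    by rewrite !ff1 // f1e // /restrict xD1 x'D1.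
  have [x'W1 x'P] : x' \notin W y /\ x' \notin P y.
    by apply/andP; move: x'W; rewrite in_setU negb_or.
  have xW : x \notin W y by apply: contra x'W => xW; apply: W_nbr xW xx'.
  rewrite !ff2 //; apply: f2e.
  + by rewrite /Z2 in_setU in_setD xW xZ.
  + by rewrite /Z2 in_setU in_setD in_setI (negPf x'Z) (negPf x'P) andbF.
  + by rewrite /restrict /D2 !in_setD xW xD x'W1 x'D.
(* Defects do not add up: [P y] is precoloured for [f2], so its vertices share no colour with
   neighbours outside [Z2], and each vertex is bounded by [f1] or by [f2] alone. *)
have [xW|xW] := boolP (x \in W y :|: P y).
  apply: leq_trans (f1d x xZ); apply/subset_leq_card/subsetP=> x'.
  rewrite !in_set => /andP[xx' fx]; have xD := eD xx'; have x'D := eD2 xx'.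
  have xD1 : x \in D1 by rewrite /D1 inE xD in_setU xW.
  have [x'W|] := boolP (x' \in W y :|: P y :|: Z).
    have x'D1 : x' \in D1 by rewrite /D1 inE x'D.
    by rewrite /restrict xD1 x'D1 xx' -!ff1.
  rewrite in_setU negb_or => /andP[+ x'Z]; rewrite in_setU negb_or => /andP[x'W x'P].
  have xNW : x \notin W y.
    by apply/negP=> xNW; have := W_nbr xNW xx'; rewrite in_setU (negPf x'W) (negPf x'P).
  have : f2 x != f2 x'.
    apply: f2e.
    + by move: xW; rewrite in_setU (negPf xNW) /= => xP; rewrite /Z2 in_setU in_setI xP xD orbT.
    + by rewrite /Z2 in_setU in_setD in_setI (negPf x'Z) (negPf x'P) andbF.
    + by rewrite /restrict /D2 !in_setD xNW xD x'W x'D.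
  by rewrite -!ff2 // eq_sym fx.
have [xNW xP] : x \notin W y /\ x \notin P y.
  by apply/andP; move: xW; rewrite in_setU negb_or.
have xZ2 : x \notin Z2 by rewrite /Z2 in_setU in_setD in_setI (negPf xZ) (negPf xP) andbF.
apply: leq_trans (f2d x xZ2); apply/subset_leq_card/subsetP=> x'.
rewrite !in_set => /andP[xx' fx]; have xD := eD xx'; have x'D := eD2 xx'.
have x'W : x' \notin W y.
  by apply: contra xW => x'W; apply: (W_nbr x'W); rewrite e_sym.
by rewrite /restrict /D2 !in_setD xNW xD x'W x'D xx' -!ff2.
Qed.

(** [Z] uses at most [4k + 1] of the [6k + 3] colours. The other [2k + 2] suffice for a private
    colour on each vertex of [X] and two colours for the bipartite graph [U]. *)
Lemma extend_center : exists g : T -> 'I_(6 * k + 3),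
  [/\ forall x, x \in Z -> g x = f0 x,
      forall x z, x \in X :|: U -> x \notin Z -> z \in Z -> g x != f0 z &
      forall x y, x \in X :|: U -> y \in X :|: U -> x \notin Z -> y \notin Z -> e x y ->
        g x != g y].
Proof.
pose C := ~: (f0 @: Z); pose idx x := if x \in X then index x (enum X) else #|X| + c x.
have cC : #|X| + 2 <= #|C|.
  have := cardsC (f0 @: Z); have := leq_imset_card f0 Z; rewrite card_ord -/C.
  move: leZ leX; clear; set u := #|_|; set v := #|_|; set w := #|_|; set x := #|_|.
  by clearbody u v w x; lia.
have idxX x : x \in X -> idx x < #|X|.
  by move=> xX; rewrite /idx xX cardE index_mem mem_enum.
have idxC x : idx x < #|C|.
  have [/idxX lt|xX] := boolP (x \in X); first by apply: leq_trans lt (leq_trans (leq_addr _ _) cC).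
  by rewrite /idx (negPf xX); apply: leq_trans cC; rewrite addn2 ltnS -addn1 leq_add2l; case: (c x).
pose g x := if x \in Z then f0 x else nth (f0 x) (enum C) (idx x).
have gC x : x \notin Z -> g x \in C.
  by move=> xZ; rewrite /g (negPf xZ) -mem_enum mem_nth // -cardE.
exists g; split=> [x xZ|x z _ xZ zZ|x y xXU yXU xZ yZ xy]; first by rewrite /g xZ.
  by have := gC x xZ; rewrite inE; apply: contraNneq => ->; apply: imset_f.
rewrite /g (negPf xZ) (negPf yZ) (set_nth_default (f0 x) (f0 y)) -?cardE //.
rewrite nth_uniq -?cardE ?enum_uniq //.
have xNy : x != y by apply: contraTneq xy => ->; rewrite e_irr.
have [xX|xX] := boolP (x \in X); have [yX|yX] := boolP (y \in X).
- rewrite /idx xX yX; apply: contraNneq xNy => E.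
  by rewrite -[x](nth_index x (_ : x \in enum X)) ?mem_enum // E nth_index ?mem_enum.
- by rewrite neq_ltn; apply/orP; left; rewrite {2}/idx (negPf yX) (leq_trans (idxX x xX)) ?leq_addr.
- by rewrite neq_ltn; apply/orP; right; rewrite {2}/idx (negPf xX) (leq_trans (idxX y yX)) ?leq_addr.
rewrite /idx (negPf xX) (negPf yX) eqn_add2l.
move: xXU yXU; rewrite !in_setU (negPf xX) (negPf yX) /= => xU yU.
by have := Uc xU yU xy; case: (c x); case: (c y).
Qed.

(** Each piece is coloured with its part of [Z] and its boundary [P y] precoloured, at most
    [2k + (2k + 1)] vertices. Vertices of [X] and [U] outside [Z] then get no neighbour of their own
    colour. *)
Lemma extend_small_pieces : (forall y, #|Z :&: W y| <= 2 * k) -> exists f, extends e d Z f0 f.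
Proof.
move=> small; have [g [gZ gXUZ gXU]] := extend_center.
pose D' y := D :&: (W y :|: P y); pose Z' y := D :&: ((Z :&: W y) :|: P y).
have /fin_all_exists[h Hh] y : exists f, extends (restrict (D' y) e) d (Z' y) g f.
  apply: IH.
  - rewrite properE subsetIl; apply/negP=> /subsetP DD'.
    suff : #|U :&: D| <= #|a y|.
      move: geU (proj2 (aU y)); clear; set u := #|_|; set v := #|_|; clearbody u v; lia.
    apply/subset_leq_card/subsetP=> u; rewrite inE => /andP[uU uD]; move: (DD' u uD).
    have uX : u \notin X by rewrite (disjointFl XU).
    have uW : u \notin W y by rewrite !inE uU orbT.
    by rewrite /D' /P in_setI !in_setU uD (negPf uW) (negPf uX).
  - by apply: setIS; apply: setSU; apply: subsetIr.
  apply: leq_trans (subset_leq_card (subsetIr _ _)) _.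
  apply: leq_trans (leq_card_setU _ _) _; apply: leq_trans (leq_add (small y) (cP y)) _.
  by clear; lia.
pose f x := if x \in X :|: U then g x else h (lab x) x.
have fXU x : x \in X :|: U -> f x = g x by move=> xXU; rewrite /f xXU.
have Wlab x : x \notin X :|: U -> x \in W (lab x) by move=> xN; rewrite inE xN eqxx.
have fh y x : x \in D' y -> f x = h y x.
  have [hZ _ _] := Hh y; rewrite /D' in_setI in_setU => /andP[xD /orP[xW|xP]].
    by move: xW; rewrite inE /f => /andP[/negPf-> /eqP->].
  by rewrite fXU ?(PXU xP) // hZ // /Z' in_setI in_setU xD xP orbT.
have fZ x : x \in Z -> f x = f0 x.
  move=> xZ; have [xXU|xN] := boolP (x \in X :|: U); first by rewrite fXU // gZ.
  have [hZ _ _] := Hh (lab x); have xD := subsetP ZD x xZ; have xW := Wlab x xN.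
  rewrite (@fh (lab x)); last by rewrite /D' in_setI in_setU xD xW.
  by rewrite hZ ?gZ // /Z' in_setI in_setU in_setI xD xZ xW.
have W_Z' y x : x \in W y -> x \notin Z -> x \notin Z' y.
  move=> xW xZ; rewrite /Z' in_setI in_setU in_setI (negPf xZ) /=.
  by apply/negP=> /andP[_ /(WP xW)].
have cross x x' y : x' \in W y -> x' \notin Z -> x \in Z :|: P y -> e x x' -> f x != f x'.
  move=> x'W x'Z xZP xx'; have [_ he _] := Hh y; have xD := eD xx'; have x'D := eD2 xx'.
  have xWP : x \in W y :|: P y by apply: (W_nbr x'W); rewrite e_sym.
  have xD' : x \in D' y by rewrite /D' in_setI xD.
  have x'D' : x' \in D' y by rewrite /D' in_setI x'D in_setU x'W.
  rewrite !(@fh y) //; apply: he; last by rewrite /restrict xD' x'D'.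
    rewrite /Z' in_setI xD in_setU in_setI; move: xWP xZP.
    rewrite [x \in W y :|: _]in_setU [x \in Z :|: _]in_setU.
    by case: (x \in P y); rewrite ?orbT ?orbF //= => -> ->.
  exact: W_Z'.
exists f; split=> // [x x' xZ x'Z xx'|x xZ].
  have [x'XU|x'N] := boolP (x' \in X :|: U).
    by rewrite (fZ x) // (fXU x') // eq_sym gXUZ.
  by apply: (cross x x' (lab x')) => //; [apply: Wlab | rewrite in_setU xZ].
have [xXU|xN] := boolP (x \in X :|: U).
  rewrite (_ : [set y | _] = set0) ?cards0 //; apply/setP=> x'; rewrite !in_set.
  apply/negP=> /andP[xx' /eqP ff].
  have [x'Z|x'Z] := boolP (x' \in Z).
    by move: ff; rewrite (fZ x') // (fXU x) // => /esym/eqP; rewrite (negPf (gXUZ x x' xXU xZ x'Z)).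
  have [x'XU|x'N] := boolP (x' \in X :|: U).
    by have := gXU x x' xXU x'XU xZ x'Z xx'; rewrite -!fXU // ff eqxx.
  have x'W := Wlab x' x'N.
  have : f x != f x'; last by rewrite ff eqxx.
  apply: (cross x x' (lab x')) => //; have x'x : e x' x by rewrite e_sym.
  have := W_nbr x'W x'x; rewrite in_setU => /orP[|xP]; last by rewrite in_setU xP orbT.
  by rewrite inE xXU.
have xW := Wlab x xN; have [_ _ hd] := Hh (lab x).
apply: leq_trans (hd x (W_Z' _ _ xW xZ)); apply/subset_leq_card/subsetP=> x'.
rewrite !in_set => /andP[xx' ff].
have xD' : x \in D' (lab x) by rewrite /D' in_setI (eD xx') in_setU xW.
have x'D' : x' \in D' (lab x) by rewrite /D' in_setI (eD2 xx') (W_nbr xW xx').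
by rewrite /restrict xD' x'D' xx' -!fh.
Qed.

Lemma extend_decomposed : exists f, extends e d Z f0 f.
Proof.
have [/existsP[y]|/existsPn small] := boolP [exists y, 2 * k < #|Z :&: W y|].
  exact: extend_large_piece.
by apply: extend_small_pieces => y; rewrite leqNgt.
Qed.

End Decomposed.

(** * The induction on vertices and edges *)

Lemma odd_minor_subrel (T : finType) (e e' : rel T) (t : nat) :
  subrel e' e -> has_odd_Kt_minor e' t -> has_odd_Kt_minor e t.
Proof.
move=> sub [V [E [alpha [Vd Vt Ea mono]]]]; exists V, E, alpha; split=> //.
  move=> i; have [t1 t2 t3 t4 t5] := Vt i; split=> // x y /t1[/sub].
  by split.
move=> i j ij; have [x [y [xV yV /sub xy al]]] := mono i j ij.
by exists x, y.
Qed.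

Definition degree (T : finType) (e : rel T) (x : T) : nat := #|[set y | e x y]|.

Definition edge_pairs (T : finType) (e : rel T) : {set T * T} := [set p | e p.1 p.2].

(* Chosen so that [threshold * h <= C * (|A| + |B|)], where [h] counts the high vertices,
   [|A| <= z.+1 * h] and [|B| <= K * |A|], is impossible in a graph without a core. *)
Definition threshold (s N z : nat) : nat :=
  2 * (2 ^ N * (2 * s)) * (2 ^ N * s + N * 2 ^ (2 ^ N * s)).+1 * z.+1.

(** Let [A] consist of [Z] and the high vertices, and [B] of the rest; all neighbours of [B] lie in
    [A]. If [B] is much larger than [A], the bipartite lemma applies; otherwise the high degrees
    alone make the graph dense on [D]. *)
Lemma has_core_without_light_edges (T : finType) (e : rel T) (s N z : nat) (D Z : {set T}) :
    symmetric e -> irreflexive e -> (forall x y, e x y -> x \in D) -> Z \subset D ->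
    #|Z| <= z -> z < s -> ~~ (D \subset Z) ->
    (forall v, v \in D -> v \notin Z -> s <= degree e v) ->
    (forall u v, u \notin Z -> v \notin Z -> e u v ->
       (threshold s N z < degree e u) || (threshold s N z < degree e v)) ->
  has_core e s N.
Proof.
move=> e_sym e_irr eD ZD leZ zs DZ degs light.
have eD2 x y : e x y -> y \in D by rewrite e_sym; apply: eD.
have s0 : 0 < s by apply: leq_ltn_trans zs.
set L := threshold s N z in light.
pose Hi := [set v in D :\: Z | L < degree e v].
pose A := Z :|: Hi; pose B := D :\: A.
have dAB : [disjoint A & B].
  rewrite -setI_eq0; apply/eqP/setP=> x.
  by rewrite /B in_setI in_setD in_set0 andbA andbN.
have lowB b : b \in B -> [/\ b \in D, b \notin Z & degree e b <= L].
  rewrite !inE negb_or => /andP[/andP[bZ +] bD]; rewrite bZ bD /= -leqNgt.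
  by split.
have nbB b : b \in B -> [set x in A | e b x] = [set x | e b x].
  move=> bB; have [bD bZ bL] := lowB b bB; apply/setP=> x; rewrite [LHS]in_set [RHS]in_set.
  case bx: (e b x); rewrite ?andbF // andbT /A in_setU; case: (boolP (x \in Z)) => //= xZ.
  rewrite !inE xZ (eD2 _ _ bx) /=; have := light b x bZ xZ bx.
  by rewrite ltnNge bL.
have sB b : b \in B -> s <= #|[set x in A | e b x]|.
  by move=> bB; rewrite nbB //; have [bD bZ _] := lowB b bB; apply: degs.
(* Otherwise a vertex of [B] would have its at least [s] neighbours among the fewer than [s]
   vertices of [Z]. *)
have [h0 h0H] : exists h, h \in Hi.
  apply/set0Pn/negP=> /eqP Hi0; have [b bD bZ] := subsetPn DZ.
  have bB : b \in B by rewrite /B /A Hi0 setU0 in_setD bZ.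
  have := sB b bB; rewrite leqNgt => /negP; apply.
  apply: leq_ltn_trans zs; apply: leq_trans leZ; apply/subset_leq_card/subsetP=> x.
  by rewrite in_set /A Hi0 setU0 => /andP[].
have H0 : 0 < #|Hi| by apply/card_gt0P; exists h0.
have cA : #|A| <= z.+1 * #|Hi|.
  apply: leq_trans (leq_card_setU _ _) _; rewrite mulSn addnC leq_add2l.
  by apply: leq_trans leZ _; rewrite leq_pmulr.
pose K := 2 ^ N * s + N * 2 ^ (2 ^ N * s).
case: (ltnP (K * #|A|) #|B|) => [ltB|leB].
  exact: (bipartite_has_core e_sym dAB s0 sB ltB).
have D0 : D != set0 by apply/set0Pn; exists h0; move: h0H; rewrite !inE => /andP[/andP[]].
apply: (dense_has_core e_sym e_irr s0 D0); set C := 2 * _.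
have cD : #|D| <= #|A| + #|B|.
  apply: leq_trans (leq_card_setU _ _); apply/subset_leq_card/subsetP=> x xD.
  by rewrite in_setU /B in_setD xD andbT orbN.
apply: leq_trans (_ : L * #|Hi| <= _).
  apply: leq_trans (_ : C * (K.+1 * #|A|) <= _).
    by rewrite leq_mul2l (leq_trans cD) ?orbT // mulSn leq_add2l.
  by rewrite /L /threshold -/C -/K -!mulnA !leq_mul2l cA !orbT.
rewrite mulnC -sum_nat_const /degree_sum.
have HiD : Hi \subset D by apply/subsetP=> x; rewrite !inE => /andP[/andP[]].
rewrite [X in _ <= X](big_setID Hi) /= (setIidPr HiD); apply: leq_trans (leq_addr _ _).
apply: leq_sum => x; rewrite inE => /andP[_ /ltnW le]; apply: leq_trans le _.
apply/subset_leq_card/subsetP=> y; rewrite !inE => xy.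
by rewrite xy (eD2 _ _ xy).
Qed.

Section Extension.

Variable k : nat.
Let s := 6 * k + 3.
Let N := 3 * k + 4.
Let z := 4 * k + 1.
Let L := threshold s N z.

Lemma extend_precoloring (T : finType) (e : rel T) (D Z : {set T}) (f0 : T -> 'I_s) :
    symmetric e -> irreflexive e -> (forall x y, e x y -> x \in D) -> Z \subset D ->
    #|Z| <= z -> ~ has_odd_Kt_minor e k.+2 ->
  exists f, extends e L Z f0 f.
Proof.
(* Passing to a proper subset of [D] lowers the first summand, deleting an edge the second. *)
have [n] := ubnP (#|D| + #|edge_pairs e|).
elim: n e D Z f0 => // n IH e D Z f0 ltn e_sym e_irr eD ZD leZ nominor.
have eD2 x y : e x y -> y \in D by rewrite e_sym; apply: eD.
have IHD (D' Z' : {set T}) (f0' : T -> 'I_s) : D' \proper D -> Z' \subset D' -> #|Z'| <= z ->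
    exists f, extends (restrict D' e) L Z' f0' f.
  move=> D'D Z'D' leZ'.
  have sub : subrel (restrict D' e) e by move=> x y /and3P[].
  apply: (IH _ D') => //.
  - rewrite -ltnS; apply: leq_trans ltn; rewrite ltnS -addSn; apply: leq_add; first exact: proper_card.
    by apply/subset_leq_card/subsetP=> p; rewrite !inE => /sub.
  - exact: restrict_sym.
  - by move=> x; rewrite /restrict e_irr !andbF.
  - by move=> x y /and3P[].
  - by move=> /(odd_minor_subrel sub).
have [DZ|DZ] := boolP (D \subset Z).
  exists f0; split=> // [x y _ yZ /eD2 /(subsetP DZ)|x xZ]; first by rewrite (negPf yZ).
  rewrite (_ : [set y | _] = set0) ?cards0 //; apply/setP=> y; rewrite !inE.
  by apply/negP=> /andP[/eD /(subsetP DZ)]; rewrite (negPf xZ).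
(* A vertex of degree below [s] is coloured last, with a colour absent from its neighbours. *)
have [/existsP[v /and3P[vD vZ degv]]|/existsPn bigdeg] :=
  boolP [exists v, [&& v \in D, v \notin Z & degree e v < s]].
  have [|||f [fZ fe fd]] := IHD (D :\ v) Z f0 => //.
  - exact: properD1.
  - by rewrite subsetD1 ZD.
  have [col colN] : exists col, col \notin f @: [set y | e v y].
    have : 0 < #|~: (f @: [set y | e v y])|.
      have := cardsC (f @: [set y | e v y]); rewrite card_ord.
      have := leq_imset_card f [set y | e v y]; move: degv; rewrite /degree -/s; clear.
      by set a := #|_|; set b := #|_|; set c := #|_|; clearbody a b c; lia.
    by case/card_gt0P=> col; rewrite inE; exists col.
  pose g x := if x == v then col else f x.
  have gN x y : e x y -> y != v -> x != v -> g x = f x /\ g y = f y /\ restrict (D :\ v) e x y.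
    by move=> xy /negPf yv /negPf xv; rewrite /g /restrict !inE yv xv (eD _ _ xy) (eD2 _ _ xy) xy.
  have gv y : e v y -> g y != g v.
    move=> vy; rewrite /g eqxx; have [yv|_] := eqVneq y v; first by rewrite yv e_irr in vy.
    by apply: contraNneq colN => <-; apply: imset_f; rewrite inE.
  exists g; split=> [x xZ|x y xZ yZ xy|x xZ].
  - rewrite /g; case: eqP => [xv|_]; last exact: fZ.
    by rewrite -xv xZ in vZ.
  - have xv : x != v by apply: contraNneq vZ => <-.
    have [yv|yv] := eqVneq y v; first by rewrite yv gv // -yv e_sym.
    by have [-> [-> xy']] := gN x y xy yv xv; apply: fe.
  have [->|xv] := eqVneq x v.
    rewrite (_ : [set y | _] = set0) ?cards0 //; apply/setP=> y; rewrite !inE.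
    by apply/negP=> /andP[/gv /negPf->].
  apply: leq_trans (fd x xZ); apply/subset_leq_card/subsetP=> y; rewrite !inE => /andP[xy gxy].
  have yv : y != v.
    by apply: contraTneq gxy => yv; rewrite yv eq_sym gv // -yv e_sym.
  by have [<- [<- ->]] := gN x y xy yv xv.
(* An edge between low vertices outside [Z] may be deleted: the defect of its ends never exceeds
   their degree, and other vertices keep their edges. *)
have [/existsP[u /existsP[v /and5P[uZ vZ uv du dv]]]|/existsPn nolight] :=
  boolP [exists u, exists v, [&& u \notin Z, v \notin Z, e u v, degree e u <= L & degree e v <= L]].
  pose e' := remove_edge e u v.
  have sub : subrel e' e by move=> x y /andP[].
  have e'E x y : x != u -> x != v -> e' x y = e x y.
    by move=> /negPf xu /negPf xv; rewrite /e' /remove_edge /= xu xv andbT.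
  have [|||||||f [fZ fe fd]] := IH e' D Z f0 => //.
  - rewrite -ltnS; apply: leq_trans ltn; rewrite ltnS -addnS leq_add2l.
    apply: proper_card; apply/properP; split; first by apply/subsetP=> p; rewrite !inE => /sub.
    by exists (u, v); rewrite inE // /e' /remove_edge /= !eqxx andbF.
  - move=> x y; rewrite /e' /remove_edge /= e_sym; congr (_ && ~~ _).
    by rewrite orbC; congr (_ || _); rewrite andbC.
  - by move=> x; apply/negbTE/negP=> /sub; rewrite e_irr.
  - by move=> x y /sub/eD.
  - by move=> /(odd_minor_subrel sub).
  exists f; split=> // [x y xZ yZ xy|x xZ].
    by apply: fe => //; rewrite e'E //; apply: contraTneq xZ => ->.
  have degx y : y \in [set u; v] -> degree e y <= L by rewrite !inE => /orP[]/eqP->.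
  have [xuv|] := boolP (x \in [set u; v]).
    apply: leq_trans (degx x xuv); apply/subset_leq_card/subsetP=> y.
    by rewrite !inE => /andP[].
  rewrite !inE negb_or => /andP[xu xv]; apply: leq_trans (fd x xZ).
  by apply/subset_leq_card/subsetP=> y; rewrite !inE e'E.
have [|||c [S [R [coreR leS]]]] :=
    @has_core_without_light_edges _ e s N z D Z e_sym e_irr eD ZD leZ _ DZ _ _.
- by rewrite /z /s; lia.
- by move=> v vD vZ; have := bigdeg v; rewrite vD vZ /= -leqNgt.
- move=> u v uZ vZ uv; move: (nolight u); rewrite negb_exists => /forallP/(_ v).
  by rewrite uZ vZ uv /= negb_and -!ltnNge.
have SD : S \subset D.
  have N0 : 0 < N by rewrite /N addn4.
  have [_ _ _ _ SR] := coreR; apply/subsetP=> x xS.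
  by have [r _ /andP[/eD]] := SR x (Ordinal N0) xS.
have [[x [q pk]]|[X [U [col [F [lab [a [[leX SXU XU] Uc labE att aU]]]]]]]] :=
    packing_or_decomposition S e_sym e_irr k.
  case: nominor; apply: (odd_minor_of_packing e_sym coreR _ _ pk).
    by apply: leq_trans leS; rewrite /s; lia.
  by rewrite /N; lia.
apply: (extend_decomposed e_sym e_irr f0 eD ZD leZ leX XU Uc labE att aU _ IHD).
(* This gives the required [4k + 3] vertices, since [|S| >= 6k + 3] and [|X| <= 2k]. *)
have : #|S :\: X| <= #|U :&: D|.
  by apply: subset_leq_card; rewrite subsetI SXU (subset_trans (subsetDl _ _) SD).
apply: leq_trans; rewrite cardsD.
have := subset_leq_card (subsetIr S X); move: leS leX; rewrite /s; clear.
by set u := #|S|; set v := #|X|; set w := #|_|; clearbody u v w; lia.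
Qed.

End Extension.

Theorem mainTheorem1 (t : nat) (ht : 2 <= t) :
  exists d : nat,
    forall (T : finType) (e : rel T),
      symmetric e -> irreflexive e ->
      ~ has_odd_Kt_minor e t ->
      defective_colorable e (6 * t - 9) d.
Proof.
case: t ht => [|[|k]] // _; have -> : 6 * k.+2 - 9 = 6 * k + 3 by lia.
exists (threshold (6 * k + 3) (3 * k + 4) (4 * k + 1)) => T e e_sym e_irr nominor.
have q0 : 0 < 6 * k + 3 by rewrite addn3.
have [|||f [_ _ fd]] := @extend_precoloring k T e setT set0 (fun _ => Ordinal q0) e_sym e_irr _ _ _ nominor.
- by move=> x y; rewrite inE.
- exact: sub0set.
- by rewrite cards0.
by exists f => x; apply: fd; rewrite inE.
Qed.
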